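(* Every minimally vertically $4$-connected binary matroid with at least six elements has a $4$-element cocircuit.
   Context: For a matroid $M$ with ground set $E$ and rank function $r$, the connectivity function is $\lambda_M(X) = r(X) + r(E-X) - r(M)$. For a positive integer $j$, a partition $(X,Y)$ of $E$ is a vertical $j$-separation of $M$ if $\lambda_M(X) < j$ and $\min\{r(X), r(Y)\} \ge j$. For an integer $k \ge 2$, $M$ is vertically $k$-connected if it has no vertical $j$-separation with $j < k$. $M$ is minimally vertically $k$-connected if it is vertically $k$-connected and $M \setminus e$ is not vertically $k$-connected for every element $e$ of $M$. *)

(* Defs.v *)
From HB Require Import structures.
From mathcomp Require Import all_boot all_order all_algebra.

Set Implicit Arguments.
Unset Strict Implicit.
Unset Printing Implicit Defensive.

Import GRing.Theory.

(* The ground set is a subset of T rather than T itself, so that deleting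
   elements does not change the ambient type. *)
Record matroid (T : finType) := Matroid {
  ground : {set T};
  indep : {set {set T}};
  indep_ground : forall I : {set T}, I \in indep -> I \subset ground;
  indep0 : set0 \in indep;
  indepS : forall I J : {set T}, J \in indep -> I \subset J -> I \in indep;
  indep_aug : forall I J : {set T}, I \in indep -> J \in indep -> #|I| < #|J| ->
    exists2 e, e \in J :\: I & e |: I \in indep
}.

Section Matroid.
Variable T : finType.
Implicit Types (M : matroid T) (B C I J X Y : {set T}) (e : T).

Definition rank M X : nat := \max_(I in indep M | I \subset X) #|I|.

Definition is_basis M B : bool := maxset [pred I | I \in indep M] B.

Definition is_circuit M C : bool :=
  minset [pred X : {set T} | (X \subset ground M) && (X \notin indep M)] C.

Lemma card_indep_basis M B I : is_basis M B -> I \in indep M -> #|I| <= #|B|.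
Proof.
move=> /maxsetP[/= Bi Bmax] Ii; rewrite leqNgt; apply/negP => ltBI.
have [e /setDP[_ eB] eBi] := indep_aug Bi Ii ltBI.
by move/negP: eB; apply; rewrite -(Bmax _ eBi (subsetUr _ _)) setU11.
Qed.

Lemma exists_basis M : exists B, is_basis M B.
Proof.
have [B Bb _] := @maxset_exists _ [pred I | I \in indep M] set0 (indep0 M).
by exists B.
Qed.

Lemma basis_extend M B I : is_basis M B -> I \in indep M ->
  exists J, [/\ is_basis M J, I \subset J & J \subset I :|: B].
Proof.
move=> Bb Ii.
pose P := [pred J : {set T} | (J \in indep M) && (J \subset I :|: B)].
have PI : P I by rewrite /= Ii subsetUl.
have [J /maxsetP[/= /andP[Ji sJ] Jmax] sIJ] := maxset_exists PI.
have Bi : B \in indep M by case/maxsetP: Bb.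
have leBJ : #|B| <= #|J|.
  rewrite leqNgt; apply/negP => ltJB.
  have [e /setDP[eB eJ] eJi] := indep_aug Ji Bi ltJB.
  move/negP: eJ; apply; rewrite -(Jmax (e |: J)) ?setU11 ?subsetUr //.
  by rewrite eJi subUset sJ sub1set inE eB orbT.
exists J; split=> //; apply/maxsetP; split=> // K /= Ki sJK; apply/eqP.
by rewrite eq_sym eqEcard sJK (leq_trans (card_indep_basis Bb Ki)).
Qed.

Definition delete_indep M e : {set {set T}} :=
  [set I in indep M | I \subset ground M :\ e].

Lemma delete_indep_ground M e I :
  I \in delete_indep M e -> I \subset ground M :\ e.
Proof. by rewrite inE => /andP[]. Qed.

Lemma delete_indep0 M e : set0 \in delete_indep M e.
Proof. by rewrite inE indep0 sub0set. Qed.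

Lemma delete_indepS M e I J :
  J \in delete_indep M e -> I \subset J -> I \in delete_indep M e.
Proof.
rewrite !inE => /andP[Ji sJ] sIJ.
by rewrite (indepS Ji sIJ) (subset_trans sIJ sJ).
Qed.

Lemma delete_indep_aug M e I J :
  I \in delete_indep M e -> J \in delete_indep M e -> #|I| < #|J| ->
  exists2 f, f \in J :\: I & f |: I \in delete_indep M e.
Proof.
rewrite !inE => /andP[Ii sI] /andP[Ji sJ] ltIJ.
have [f fJI fIi] := indep_aug Ii Ji ltIJ; exists f => //.
rewrite inE fIi subUset sI sub1set andbT.
by apply: (subsetP sJ); case/setDP: fJI.
Qed.

Definition delete M e : matroid T :=
  Matroid (@delete_indep_ground M e) (@delete_indep0 M e)
          (@delete_indepS M e) (@delete_indep_aug M e).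

Definition dual_indep M : {set {set T}} :=
  [set I : {set T} | (I \subset ground M) &&
                     [exists B, is_basis M B && [disjoint I & B]]].

Lemma dual_indep_ground M I : I \in dual_indep M -> I \subset ground M.
Proof. by rewrite inE => /andP[]. Qed.

Lemma dual_indep0 M : set0 \in dual_indep M.
Proof.
rewrite inE sub0set; have [B Bb] := exists_basis M.
by apply/existsP; exists B; rewrite Bb -setI_eq0 set0I eqxx.
Qed.

Lemma dual_indepS M I J :
  J \in dual_indep M -> I \subset J -> I \in dual_indep M.
Proof.
rewrite !inE => /andP[sJ /existsP[B /andP[Bb dJB]]] sIJ.
rewrite (subset_trans sIJ sJ); apply/existsP; exists B.
by rewrite Bb (disjointWl sIJ dJB).
Qed.

Lemma dual_indep_aug M I J :
  I \in dual_indep M -> J \in dual_indep M -> #|I| < #|J| ->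
  exists2 e, e \in J :\: I & e |: I \in dual_indep M.
Proof.
rewrite !inE => /andP[sI /existsP[B1 /andP[Bb1 dI1]]].
move=> /andP[sJ /existsP[B2 /andP[Bb2 dJ2]]] ltIJ.
have B2i : B2 \in indep M by case/maxsetP: Bb2.
have [B [Bb sDB sB]] := basis_extend Bb1 (indepS B2i (subsetDl B2 I)).
have dIB : [disjoint I & B].
  apply: disjointWr sB _; rewrite -setI_eq0 setIUr setU_eq0 !setI_eq0 dI1 andbT.
  by apply/pred0P => x; rewrite !inE; case: (x \in I).
case: (boolP (J :\: I \subset B)) => [sJIB | /subsetPn[e eJI eB]]; last first.
  exists e => //; rewrite inE subUset sI sub1set andbT; apply/andP; split.
    by apply: (subsetP sJ); case/setDP: eJI.
  apply/existsP; exists B; rewrite Bb -setI_eq0 setIUl setU_eq0 !setI_eq0 dIB andbT.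
  by rewrite disjoints1.
have Bi : B \in indep M by case/maxsetP: Bb.
have := card_indep_basis Bb2 Bi; rewrite leqNgt => /negP[].
have : (J :\: I) :|: (B2 :\: I) \subset B by rewrite subUset sJIB.
move/subset_leq_card; apply: leq_trans.
have -> : #|J :\: I :|: B2 :\: I| = (#|J :\: I| + #|B2 :\: I|)%N.
  rewrite cardsU; suff -> : (J :\: I) :&: (B2 :\: I) = set0.
    by rewrite cards0 subn0.
  apply/eqP; rewrite setI_eq0.
  by apply: disjointWl (subsetDl _ _) (disjointWr (subsetDl _ _) dJ2).
rewrite -(cardsID I B2) ltn_add2r.
have sBI : B2 :&: I \subset I :\: J.
  apply/subsetP => x; rewrite !inE => /andP[xB xI]; rewrite xI andbT.
  by apply/negP => xJ; move: (disjointFr dJ2 xJ); rewrite xB.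
apply: (leq_ltn_trans (subset_leq_card sBI)).
by rewrite -(ltn_add2l #|I :&: J|) cardsID setIC cardsID.
Qed.

Definition dual M : matroid T :=
  Matroid (@dual_indep_ground M) (@dual_indep0 M)
          (@dual_indepS M) (@dual_indep_aug M).

Definition is_cocircuit M C : bool := is_circuit (dual M) C.

(* The subtraction on nat is not truncated when X \subset ground M, see
   rank_ground_leq. *)
Definition connectivity M X : nat :=
  rank M X + rank M (ground M :\: X) - rank M (ground M).

Lemma rank_ground_leq M X :
  rank M (ground M) <= rank M X + rank M (ground M :\: X).
Proof.
apply/bigmax_leqP => I /andP[Ii sI]; rewrite -(cardsID X I); apply: leq_add.
  apply: (@leq_bigmax_cond _ _ (fun J : {set T} => #|J|)).
  by rewrite (indepS Ii (subsetIl _ _)) subsetIr.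
apply: (@leq_bigmax_cond _ _ (fun J : {set T} => #|J|)).
by rewrite (indepS Ii (subsetDl _ _)) setSD.
Qed.

Definition vertical_separation M (j : nat) X Y : Prop :=
  [/\ X :|: Y = ground M, [disjoint X & Y],
      connectivity M X < j & j <= minn (rank M X) (rank M Y)].

Definition vertically_connected M (k : nat) : Prop :=
  forall (j : nat) X Y, 0 < j -> j < k -> ~ vertical_separation M j X Y.

Definition minimally_vertically_connected M (k : nat) : Prop :=
  vertically_connected M k /\
  forall e, e \in ground M -> ~ vertically_connected (delete M e) k.

(* A set I is independent iff the family (v e)_(e in I) is linearly
   independent; it is a family, so parallel elements may have equal columns. *)
Definition representable (F : fieldType) M : Prop :=
  exists (m : nat) (v : T -> 'cV[F]_m),
    forall I, I \subset ground M -> (I \in indep M) = free [seq v e | e in I].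

Definition binary M : Prop := representable 'F_2 M.

End Matroid.

(* Main.v *)
Require Import Defs.
From mathcomp Require Import all_boot all_order all_algebra zify.

(* View M as a configuration of vectors over F_2.  Let r be its rank; call a
   nonempty set C with r(E - C) < r a cocycle.  Vertical 4-connectivity says that
   complementary nonspanning sets X, Y satisfy r(X) + r(Y) >= r + 3, and
   minimality gives, for each e, a separation E - e = X + Y into nonspanning sets
   with r(X) + r(Y) <= r + 2; then e lies in the closure of neither side, so M is
   simple.  Rank 3 is direct.  For r >= 4 every cocycle has at least four
   elements; suppose all have at least five.  The three hyperplanes through a
   flat of rank r - 2 show by averaging that the complement of any set of at
   most seven elements has rank at least r - 1.

   Choose (e; X, Y) with |Y| minimum and uncross it with a separation (f; A, B)
   for some f in Y: some side of one of the two has at most six elements.  Such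
   a small side contains a 4-circuit Q such that Q + e is a cocycle with
   hyperplane X := E - (Q + e).

   For y in Q, a separation (y; A, B) with e in A must split Q - y as
   one element p in A and two in B (otherwise two 5-element cocycles share three
   elements, or a side is too small).  Intersecting with X gives a
   2-separation (A', B') of M|X with e + p in span A' and y + p in span B'.
   Carrying this out for f in Q and then for its partner p(f) gives two
   2-separations of M|X; if Z is an intersection of sides, the recorded vectors
   usually make the other side absorb Q + e up to rank 2, forcing |Z| <= 1, and
   uncrossing contradicts the size of the sides. *)

Set Implicit Arguments.
Unset Strict Implicit.
Unset Printing Implicit Defensive.

Import GRing.Theory.

(** * Linear algebra over F_2 *)

Section BinarySpace.
Variable V : vectType 'F_2.
Implicit Types (U W : {vspace V}) (x y z : V).
Local Open Scope ring_scope.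

Lemma addxx x : x + x = 0.
Proof. by rewrite -mulr2n -scaler_nat pchar_Zp // scale0r. Qed.

Lemma oppx x : - x = x.
Proof. by apply/eqP; rewrite eq_sym -addr_eq0 addxx. Qed.

Lemma addxK x y : x + (x + y) = y.
Proof. by rewrite addrA addxx add0r. Qed.

Lemma addx_eq0 x y : (x + y == 0) = (x == y).
Proof. by rewrite addr_eq0 oppx. Qed.

Lemma memv_addr U x y : x \in U -> (x + y \in U) = (y \in U).
Proof. by move=> xU; rewrite rpredDl. Qed.

(** The only scalars are 0 and 1, so the line through [w] is {0, w}. *)
Lemma memv_add_line U y w :
  (y \in (U + <[w]>)%VS) = (y \in U) || (y + w \in U).
Proof.
apply/memv_addP/orP => [[u uU [z /vlineP[k ->] ->]]|[yU|ywU]].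
- have : k \in [:: 0; 1] by case: k => -[|[|[]]].
  rewrite !inE => /orP[]/eqP->; first by left; rewrite scale0r addr0.
  by right; rewrite scale1r -addrA addxx addr0.
- by exists y => //; exists 0; rewrite ?addr0 ?rpred0.
- by exists (y + w) => //; exists w; rewrite ?memv_line // -addrA addxx addr0.
Qed.

Lemma dim_add_line U x : \dim (U + <[x]>) = (\dim U + (x \notin U))%N.
Proof.
case: (boolP (x \in U)) => xU.
  by rewrite addn0; have /addv_idPl-> : (<[x]> <= U)%VS by [].
apply/eqP; rewrite eqn_leq; apply/andP; split.
  apply: leq_trans (dimv_add_leqif _ _) _.
  by rewrite leq_add2l dim_vline; case: eqP.
rewrite addn1 ltn_neqAle dimvS ?addvSl // andbT.
apply: contra xU => /eqP e.
have /eqP-> : U == (U + <[x]>)%VS by rewrite eqEdim addvSl /= -e.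
exact: subvP (addvSr _ _) _ (memv_line x).
Qed.

(* A subspace of codimension 1 in U is the kernel of an 'F_2-valued functional
   on U, so the sum of two vectors of U outside it falls back into it. *)
Lemma memv_add_codim1 U W x y : (W <= U)%VS -> (\dim U <= (\dim W).+1)%N ->
  x \in U -> y \in U -> x \notin W -> y \notin W -> x + y \in W.
Proof.
move=> WU dU xU yU xW yW.
have sub : (W + <[x]> <= U)%VS by rewrite subv_add WU.
have /eqP e : (W + <[x]>)%VS == U by rewrite eqEdim sub dim_add_line xW addn1.
by move: yU; rewrite -e memv_add_line (negPf yW) /= addrC.
Qed.

(** Over F_2 two distinct nonzero vectors are independent, so [p] and [q] span [U], and a plane has
    only four vectors. *)
Lemma mem_dim2 U p q x : (\dim U <= 2)%N -> p \in U -> q \in U ->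
  p != 0 -> q != 0 -> p != q -> x \in U -> [|| x == 0, x == p, x == q | x == p + q].
Proof.
move=> dU pU qU p0 q0 pq xU.
have pq' : q \notin (0 + <[p]>)%VS.
  by rewrite memv_add_line !memv0 addx_eq0 negb_or q0 eq_sym.
have sub : ((0 + <[p]>) + <[q]> <= U)%VS.
  by rewrite !subv_add sub0v; apply/andP; split.
have /eqP e : ((0 + <[p]>) + <[q]>)%VS == U.
  by rewrite eqEdim sub !dim_add_line pq' dimv0 memv0 p0.
move: xU; rewrite -e !memv_add_line !memv0 !addx_eq0 -orbA.
by rewrite -{2}[q]oppx subr_eq.
Qed.

Lemma card_dim2 (T : finType) (w : T -> V) (Z : {set T}) U :
  (\dim U <= 2)%N -> {in Z &, injective w} ->
  (forall t, t \in Z -> w t \in U /\ w t != 0) -> (#|Z| <= 3)%N.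
Proof.
move=> dU inj wU; case: (leqP #|Z| 1) => [/leq_trans->//|/card_gt1P[a [b [aZ bZ ab]]]].
have [aU a0] := wU _ aZ; have [bU b0] := wU _ bZ.
have wab : w a != w b by apply: contra ab => /eqP/inj->.
rewrite cardE -(size_map w).
apply: (@uniq_leq_size _ _ [:: w a; w b; w a + w b]).
  by rewrite map_inj_in_uniq ?enum_uniq // => s t; rewrite !mem_enum; apply: inj.
move=> _ /mapP[t + ->]; rewrite mem_enum => /wU[tU t0].
by have := mem_dim2 dU aU bU a0 b0 wab tU; rewrite (negPf t0) !inE.
Qed.

End BinarySpace.

(** * Spans and ranks of families of vectors *)

Section Configuration.
Variables (T : finType) (V : vectType 'F_2) (v : T -> V).
Implicit Types (X Y Z : {set T}) (x y e f : T) (U W : {vspace V}).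

Definition sp X : {vspace V} := (\sum_(x in X) <[v x]>)%VS.
Definition rk X : nat := \dim (sp X).

Lemma mem_sp X x : x \in X -> v x \in sp X.
Proof. by move=> xX; rewrite memvE; apply: (sumv_sup x). Qed.

Lemma sp_sub X U : (forall x, x \in X -> v x \in U) -> (sp X <= U)%VS.
Proof. by move=> sub; apply/subv_sumP => x /sub; rewrite memvE. Qed.

Lemma spS X Y : X \subset Y -> (sp X <= sp Y)%VS.
Proof. by move=> /subsetP sub; apply: sp_sub => x /sub/mem_sp. Qed.

Lemma rkS X Y : X \subset Y -> rk X <= rk Y.
Proof. by move/spS; apply: dimvS. Qed.

Lemma sp0 : sp set0 = 0%VS.
Proof. by rewrite /sp big_set0. Qed.

Lemma spU X Y : sp (X :|: Y) = (sp X + sp Y)%VS.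
Proof.
apply/eqP; rewrite eqEsubv subv_add !spS ?subsetUl ?subsetUr // !andbT.
apply: sp_sub => x; rewrite inE => /orP[]/mem_sp xS.
  exact: subvP (addvSl _ _) _ xS.
exact: subvP (addvSr _ _) _ xS.
Qed.

Lemma sp1 x : sp [set x] = <[v x]>%VS.
Proof. by rewrite /sp big_set1. Qed.

Lemma spU1 x X : sp (x |: X) = (sp X + <[v x]>)%VS.
Proof. by rewrite setUC spU sp1. Qed.

Lemma rkU1 x X : rk (x |: X) = rk X + (v x \notin sp X).
Proof. by rewrite /rk spU1 dim_add_line. Qed.

Lemma rkU1_leq x X : rk (x |: X) <= (rk X).+1.
Proof. by rewrite rkU1; case: (v x \in sp X); rewrite ?addn0 ?addn1. Qed.

Lemma rk_submod X Y : rk (X :&: Y) + rk (X :|: Y) <= rk X + rk Y.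
Proof.
rewrite /rk spU -(dimv_sum_cap (sp X)) addnC leq_add2l dimvS //.
by rewrite subv_cap !spS ?subsetIl ?subsetIr.
Qed.

Lemma rkU X Y : rk (X :|: Y) <= rk X + rk Y.
Proof. by rewrite (leq_trans _ (rk_submod X Y)) // leq_addl. Qed.

Lemma rk_card X : rk X <= #|X|.
Proof.
move: {2}#|X| (leqnn #|X|) => n; elim: n X => [|n IH] X.
  by rewrite leqn0 cards_eq0 => /eqP->; rewrite /rk sp0 dimv0.
move=> Xn; case: (set_0Vmem X) => [->|[x xX]]; first by rewrite /rk sp0 dimv0.
rewrite (cardsD1 x) xX in Xn *; rewrite -{1}(setD1K xX).
by rewrite (leq_trans (rkU1_leq _ _)) // add1n ltnS IH.
Qed.

Lemma rk_lt X Y x : X \subset Y -> x \in Y -> v x \notin sp X -> rk X < rk Y.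
Proof.
move=> XY xY xX; have /rkS : x |: X \subset Y by rewrite subUset sub1set xY.
by rewrite rkU1 xX addn1.
Qed.

Lemma sp_eq X Y : X \subset Y -> rk Y <= rk X -> sp X = sp Y.
Proof. by move=> XY r; apply/eqP; rewrite eqEdim spS. Qed.

(** Adding one element raises the rank by at most one, so no intermediate rank is skipped. *)
Lemma rk_grow X Y n : X \subset Y -> rk X <= n -> n <= rk Y ->
  exists Z, [/\ X \subset Z, Z \subset Y & rk Z = n].
Proof.
move=> XY; move: {2}(n - rk X) (erefl (n - rk X)) => k; elim: k X XY => [|k IH] X XY.
  by move=> e rX nY; exists X; split=> //; lia.
move=> e rX nY.
have /subsetPn[x xY xX] : ~~ (Y \subset [set x | v x \in sp X]).
  apply/negP => /subsetP sub.
  have : rk Y <= rk X by apply/dimvS/sp_sub => x /sub; rewrite inE.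
  by lia.
rewrite inE in xX; have rx : rk (x |: X) = (rk X).+1 by rewrite rkU1 xX addn1.
have [||||Z [sZ ZY rZ]] := IH (x |: X); rewrite ?rx //; try lia.
  by rewrite subUset sub1set xY.
by exists Z; split=> //; apply: subset_trans sZ; apply: subsetUr.
Qed.

End Configuration.

(** No element of [D] lies in all three sets, so each is counted at most twice. *)
Lemma card_three_sets (T : finType) (A B C D : {set T}) :
  A \subset D -> B \subset D -> C \subset D -> A :&: B :&: C = set0 ->
  #|A| + #|B| + #|C| <= 2 * #|D|.
Proof.
move=> AD BD CD ABC; rewrite -cardsUI -addnA.
have -> : #|A :&: B| + #|C| = #|(A :&: B) :|: C| by rewrite -cardsUI ABC cards0 addn0.
rewrite mulSn mul1n leq_add // subset_leq_card // !subUset ?AD ?BD ?CD //.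
by rewrite (subset_trans (subsetIl _ _) AD).
Qed.

Lemma enum_card4 (T : finType) (Q : {set T}) : #|Q| = 4 ->
  exists a b c d, uniq [:: a; b; c; d] /\ enum Q = [:: a; b; c; d].
Proof.
rewrite cardE; have := enum_uniq Q.
by case: (enum Q) => [|a [|b [|c [|d [|]]]]] // u _; exists a, b, c, d.
Qed.

Lemma exists2_or_none (T : finType) (P R : pred T) :
  (exists2 x, P x & R x) \/ (forall x, P x -> ~~ R x).
Proof.
case: (pickP [pred x | P x && R x]) => [x /andP[Px Rx]|none]; first by left; exists x.
by right=> x Px; move: (none x); rewrite /= Px => /negbT.
Qed.

Ltac bool_cases x X Y A B E e f := rewrite !inE;
  move: (x \in X) (x \in Y) (x \in A) (x \in B) (x \in E) (x == e) (x == f);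
  clear; do 7!case.

(** * Separations of a binary configuration *)

Section Separations.
Variables (T : finType) (V : vectType 'F_2) (v : T -> V).
Implicit Types (X Y Z A B C : {set T}) (x y e f : T) (U W : {vspace V}).
Notation sp := (sp v).
Notation rk := (rk v).
Variable E : {set T}.

(* When r(X) + r(Y) - r(E) = j - 1, both ranks are at least j iff both X and Y are
   nonspanning; so the bound on ranks in a vertical separation can be replaced by
   nonspanning, uniformly in j <= 3. *)
Definition vconn4 : Prop := forall X Y, X :|: Y = E -> [disjoint X & Y] ->
  rk X < rk E -> rk Y < rk E -> rk E + 3 <= rk X + rk Y.

(** Witnesses that deleting [e] destroys 4-connectivity. Ranks are compared with [rk E], not with
    the rank of E - e, so the case where deleting [e] lowers the rank needs no separate
    treatment. *)
Definition vsep e X Y : bool :=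
  [&& X :|: Y == E :\ e, [disjoint X & Y], rk X < rk E, rk Y < rk E
    & rk X + rk Y <= rk E + 2].

Lemma vsepP e X Y : reflect
  [/\ X :|: Y = E :\ e, [disjoint X & Y], rk X < rk E, rk Y < rk E
    & rk X + rk Y <= rk E + 2] (vsep e X Y).
Proof. by apply: (iffP and5P) => -[/eqP]. Qed.

Lemma vsep_sym e X Y : vsep e X Y = vsep e Y X.
Proof.
by rewrite /vsep setUC disjoint_sym [rk X + _]addnC; congr andb; congr andb; rewrite andbCA.
Qed.

Lemma rk_exists X Y : rk X < rk Y -> exists2 y, y \in Y & v y \notin sp X.
Proof.
move=> lt; apply/subsetPn; apply: contraTN lt; rewrite -leqNgt => /subsetP sub.
by apply/dimvS/sp_sub => x /sub.
Qed.

Definition cocyc W : {set T} := [set x in E | v x \notin W].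

Lemma cocyc_sub W : cocyc W \subset E.
Proof. by apply/subsetP => x; rewrite inE => /andP[]. Qed.

Lemma sp_cocyc W : (sp (E :\: cocyc W) <= W)%VS.
Proof. by apply: sp_sub => x; rewrite !inE; case: (x \in E) => //=; rewrite andbT negbK. Qed.

(* A point off a flat F of corank 2 lies off exactly two of the three hyperplanes
   through F, so the three complements have total size 2 |E - F|. *)
Lemma three_hyperplanes X : X \subset E -> rk X + 2 <= rk E ->
  exists2 C : {set T}, C \subset E & rk (E :\: C) < rk E /\ 3 * #|C| <= 2 * #|E :\: X|.
Proof.
move=> XE rX.
have [||F [XF FE rF]] := rk_grow (v := v) (n := rk E - 2) XE; try lia.
have [w1 w1E w1F] : exists2 y, y \in E & v y \notin sp F by apply: rk_exists; lia.
have rw1 : rk (w1 |: F) = rk E - 1 by rewrite rkU1 w1F; lia.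
have [w2 w2E w2F] : exists2 y, y \in E & v y \notin sp (w1 |: F).
  by apply: rk_exists; lia.
have full : sp (w2 |: (w1 |: F)) = sp E.
  apply: sp_eq; first by rewrite !subUset !sub1set w1E w2E.
  by rewrite rkU1 w2F; lia.
pose H u := (sp F + <[u]>)%VS; pose C u := cocyc (H u).
have CX u : C u \subset E :\: X.
  apply/subsetP => x; rewrite !inE => /andP[-> xH]; rewrite andbT.
  apply: contra xH => xW; apply: subvP (addvSl _ _) _ (mem_sp v _).
  exact: (subsetP XF).
have CE u : C u \subset E := subset_trans (CX u) (subsetDl _ _).
have rC u : rk (E :\: C u) < rk E.
  have := dimvS (sp_cocyc (H u)); rewrite dim_add_line -/(rk F) -/(rk _) => le.
  by apply: leq_ltn_trans le _; case: (_ \in _) => /=; lia.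
have C0 : C (v w1) :&: C (v w2) :&: C (v w1 + v w2)%R = set0.
  apply/setP => x; rewrite !inE; apply/negP => /andP[/andP[/andP[xE n1] /andP[_ n2]] /andP[_ n3]].
  have := mem_sp v xE; rewrite -full !spU1 !memv_add_line.
  move: n1 n2 n3; rewrite !memv_add_line !negb_or => /andP[n0 n1] /andP[_ n2] /andP[_ n3].
  by rewrite (negPf n0) (negPf n1) (negPf n2) /= -addrA [(v w2 + _)%R]addrC (negPf n3).
have le := card_three_sets (CX _) (CX _) (CX _) C0.
have [u uP] : exists u, 3 * #|C u| <= 2 * #|E :\: X|.
  case: (leqP (3 * #|C (v w1)|) (2 * #|E :\: X|)) => h1; first by eexists; exact: h1.
  case: (leqP (3 * #|C (v w2)|) (2 * #|E :\: X|)) => h2; first by eexists; exact: h2.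
  by exists (v w1 + v w2)%R; lia.
by exists (C u).
Qed.

Hypothesis E_conn : vconn4.
Hypothesis E_sep : forall e, e \in E -> exists X Y, vsep e X Y.

(** Otherwise moving [e] into [X] would change no rank and give a partition of [E] that
    4-connectivity forbids. *)
Lemma vsep_notinl e X Y : e \in E -> vsep e X Y -> v e \notin sp X.
Proof.
move=> eE /vsepP[XY dXY rX rY rXY]; apply/negP => eX.
have reX : rk (e |: X) = rk X by rewrite rkU1 eX addn0.
have := @E_conn (e |: X) Y; rewrite reX => /(_ _ _ rX rY) -/(_ _ _)H.
suff : rk E + 3 <= rk X + rk Y by lia.
apply: H; first by rewrite -setUA XY setD1K.
rewrite disjoint_sym -setI_eq0 setIUr setU_eq0 !setI_eq0 [X in _ && X]disjoint_sym dXY andbT.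
rewrite disjoint_sym disjoints1; apply/negP => eY.
by move/setP/(_ e): XY; rewrite !inE eqxx eY orbT.
Qed.

Lemma vsep_notinr e X Y : e \in E -> vsep e X Y -> v e \notin sp Y.
Proof. by rewrite vsep_sym; apply: vsep_notinl. Qed.

Lemma v_neq0 x : x \in E -> v x != 0%R.
Proof.
move=> xE; have [X [Y /(vsep_notinl xE)]] := E_sep xE.
by apply: contra => /eqP->; apply: rpred0.
Qed.

(** An element parallel to [x] lies on one side of a separation of E - x, and the span of that side
    would contain [v x]. *)
Lemma v_inj : {in E &, injective v}.
Proof.
move=> x y xE yE xy; apply/eqP/negPn/negP => neq.
have [X [Y s]] := E_sep xE; have /vsepP[XY _ _ _ _] := s.
have : y \in X :|: Y by rewrite XY !inE eq_sym neq yE.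
rewrite inE => /orP[]/(mem_sp v); rewrite -xy.
  by rewrite (negPf (vsep_notinl xE s)).
by rewrite (negPf (vsep_notinr xE s)).
Qed.

Lemma card_rk2 Z : Z \subset E -> rk Z <= 2 -> #|Z| <= 3.
Proof.
move=> /subsetP ZE rZ; apply: (card_dim2 (w := v) rZ).
  by move=> x y /ZE xE /ZE yE; apply: v_inj.
by move=> x xZ; rewrite mem_sp ?v_neq0 ?ZE.
Qed.

(** By 4-connectivity [Z] and its complement are not both nonspanning; so the complement spans, and
    the bound leaves at most 2 for [rk Z]. *)
Lemma small_rk Z : Z \subset E -> rk Z < rk E -> rk Z + rk (E :\: Z) <= rk E + 2 ->
  rk Z <= 2 /\ rk (E :\: Z) = rk E.
Proof.
move=> ZE rZ le.
have := @E_conn Z (E :\: Z); rewrite -setI_eq0 setDE setICA setICr setI0 eqxx -setDE.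
have -> : Z :|: E :\: Z = E by rewrite setDE setUIr setUCr setIT; apply/setUidPr.
have := rkS v (subsetDl E Z); move=> le2 /(_ erefl isT rZ); lia.
Qed.

(** * Rank at least 4, with all cocycles of at least five elements *)

Section LargeCocycles.
Hypothesis rk_ge4 : 4 <= rk E.
Hypothesis cocycle_ge5 : forall C : {set T}, C \subset E -> rk (E :\: C) < rk E -> 5 <= #|C|.

(** If the rank dropped by two, [three_hyperplanes] would give a cocycle with at most 14/3, hence at
    most four, elements. *)
Lemma codim1 Z : #|Z| <= 7 -> rk E <= (rk (E :\: Z)).+1.
Proof.
move=> Z7; rewrite leqNgt; apply/negP => lt.
have [||C CE [rC le]] := @three_hyperplanes (E :\: Z); rewrite ?subsetDl //; try lia.
have := cocycle_ge5 CE rC.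
have : #|E :\: (E :\: Z)| <= #|Z|.
  by rewrite subset_leq_card //; apply/subsetP => x; rewrite !inE; case: (x \in E); case: (x \in Z).
by lia.
Qed.

(** A side of corank at least 2 stays nonspanning when [e] is added, so 4-connectivity applies and
    at most one is lost. If both sides have corank 1, the sum is 2 rk E - 2, and [rk_ge4]
    suffices. *)
Lemma vsep_rk_ge e X Y : e \in E -> vsep e X Y -> rk E + 2 <= rk X + rk Y.
Proof.
move=> eE s; have /vsepP[XY dXY rX rY rXY] := s.
have key A B : A :|: B = E :\ e -> [disjoint A & B] -> rk B < rk E ->
    rk A + 1 < rk E -> rk E + 2 <= rk A + rk B.
  move=> AB dAB rB rA; have reA := rkU1_leq v e A.
  have : rk E + 3 <= rk (e |: A) + rk B.
    apply: E_conn => //; last by lia.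
      by rewrite -setUA AB setD1K.
    rewrite -setI_eq0 setIUl setU_eq0 !setI_eq0 dAB andbT disjoints1.
    by apply/negP => eB; move/setP/(_ e): AB; rewrite !inE eqxx eB orbT.
  by lia.
case: (ltnP (rk X + 1) (rk E)) => lX; first exact: key.
case: (ltnP (rk Y + 1) (rk E)) => lY; last by lia.
have := key Y X; rewrite setUC disjoint_sym => /(_ XY dXY rX lY); lia.
Qed.

(** [codim1] makes [sp X] a hyperplane. The vectors of [Q] lie off it, so their pairwise sums lie in
    the intersection of [sp X] and [sp Y], of dimension at most 2. Thus [Q] sits in a coset of a
    plane; having at least four elements it fills the coset, whose sum is zero. *)
Lemma small_vsep e X Y (Q := cocyc (sp X) :\ e) : e \in E -> vsep e X Y -> #|Y| <= 6 ->
  [/\ rk E = (rk X).+1, Q \subset Y, #|Q| = 4 & (\sum_(x in Q) v x = 0)%R].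
Proof.
move=> eE s Y6; have /vsepP[XY dXY rX rY rXY] := s.
have eY : e \notin Y by apply: contra (vsep_notinr eE s) => /(mem_sp v).
have YE : Y \subset E.
  by apply: subset_trans (subsetUr X Y) _; rewrite XY subsetDl.
have EX : E :\: (e |: Y) = X.
  apply/setP => x; move/setP/(_ x): XY; move/pred0P/(_ x): dXY; rewrite !inE /=.
  by case: eqP => [->|_]; [case: (e \in X); case: (e \in Y)|]; case: (x \in X); case: (x \in Y); case: (x \in E).
have rXE : rk E = (rk X).+1.
  by have := @codim1 (e |: Y); rewrite EX cardsU1 eY add1n ltnS => /(_ Y6); lia.
have QY : Q \subset Y.
  apply/subsetP => x; rewrite !inE => /and3P[xe xE xX].
  have : x \in X :|: Y by rewrite XY !inE xe xE.
  by rewrite inE => /orP[/(mem_sp v)|//]; rewrite (negPf xX).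
have eC : e \in cocyc (sp X) by rewrite inE eE (vsep_notinl eE s).
have Q4 : 4 <= #|Q|.
  have := @cocycle_ge5 (cocyc (sp X)); rewrite cocyc_sub (cardsD1 e) eC => /(_ isT).
  by apply; apply: leq_ltn_trans rX; apply: dimvS (sp_cocyc _).
have QX x : x \in Q -> v x \in sp E /\ v x \notin sp X.
  by rewrite !inE => /and3P[_ xE ?]; rewrite mem_sp.
have [y0 y0Q] : exists y, y \in Q by apply/card_gt0P; lia.
pose L := (sp X :&: sp Y)%VS.
have dL : \dim L <= 2.
  have := dimv_sum_cap (sp X) (sp Y); rewrite -spU -/(rk _) -/(rk X) -/(rk Y) -/L.
  have : rk X < rk (X :|: Y).
    apply: (rk_lt (x := y0)); rewrite ?subsetUl ?inE ?(subsetP QY) ?orbT //.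
    by case: (QX _ y0Q).
  by lia.
have XEs : (sp X <= sp E)%VS by rewrite -EX; apply/spS/subsetDl.
have inL y z : y \in Q -> z \in Q -> (v y + v z)%R \in L.
  move=> yQ zQ; have [yE yX] := QX _ yQ; have [zE zX] := QX _ zQ.
  rewrite memv_cap [X in _ && X]rpredD ?mem_sp ?(subsetP QY) // andbT.
  by apply: (memv_add_codim1 XEs) => //; rewrite -/(rk E) rXE.
have injQ : {in Q &, injective v}.
  by move=> x y /(subsetP QY)/(subsetP YE) xE /(subsetP QY)/(subsetP YE) yE; apply: v_inj.
have Q4' : #|Q| = 4.
  apply/eqP; rewrite eqn_leq Q4 andbT (cardsD1 y0) y0Q ltnS.
  apply: (card_dim2 (w := fun z => (v z + v y0)%R) dL).
    by move=> x y /setD1P[_ xQ] /setD1P[_ yQ] /addIr; apply: injQ.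
  move=> z /setD1P[zy zQ]; rewrite inL //; split=> //.
  by rewrite addx_eq0; apply: contra zy => /eqP/injQ->.
split=> //.
have [a [b [c [d [u eQ]]]]] := enum_card4 Q4'.
rewrite -big_enum eQ !big_cons big_nil /= addr0.
have [aQ bQ cQ dQ] : [/\ a \in Q, b \in Q, c \in Q & d \in Q].
  by rewrite -!(mem_enum Q) eQ !inE !eqxx !orbT.
have neq x y : x \in Q -> y \in Q -> x != y -> v x != v y.
  by move=> xQ yQ; apply: contra => /eqP/injQ->.
move: u; rewrite /= !inE !negb_or => /and4P[/and3P[ab ac ad] /andP[bc bd] cd _].
have := mem_dim2 dL (inL _ _ aQ bQ) (inL _ _ aQ cQ) _ _ _ (inL _ _ aQ dQ).
rewrite !addx_eq0 !(inj_eq (addrI (v a))) !neq // => /(_ isT isT isT).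
rewrite (negPf (neq _ _ aQ dQ ad)) !(eq_sym (v d)) (negPf (neq _ _ bQ dQ bd))
  (negPf (neq _ _ cQ dQ cd)) /=.
rewrite addrACA addxx add0r => /eqP adbc.
by rewrite addrCA [(v a + _)%R]addrCA adbc addrA addxx.
Qed.

(* Of the four quadrants of two crossing separations, one of each opposite pair
   has rank at most 2, hence at most three elements; two such quadrants fill a
   side up to one element. *)
Lemma exists_small_vsep : exists e X Y, [/\ e \in E, vsep e X Y & #|Y| <= 6].
Proof.
pose P (p : T * {set T} * {set T}) := (p.1.1 \in E) && vsep p.1.1 p.1.2 p.2.
have [e0 e0E] : exists x, x \in E.
  by apply/card_gt0P; apply: leq_trans (rk_card v E); apply: leq_trans rk_ge4.
have [X0 [Y0 s0]] := E_sep e0E.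
have P0 : P (e0, X0, Y0) by rewrite /P /= e0E.
case: (arg_minnP (fun p : T * {set T} * {set T} => #|p.2|) P0) => -[[e X] Y] /= /andP[/= eE s] min.
have {}min e' X' Y' : e' \in E -> vsep e' X' Y' -> #|Y| <= #|Y'|.
  by move=> e'E s'; apply: (min (e', X', Y')); rewrite /P /= e'E.
clear e0 e0E X0 Y0 s0 P0.
have /vsepP[XY dXY rX rY rXY] := s.
have [f fY] : exists f, f \in Y.
  apply/card_gt0P; apply: leq_trans (rk_card v Y).
  by have := vsep_rk_ge eE s; lia.
have YE : Y \subset E by apply: subset_trans (subsetUr X Y) _; rewrite XY subsetDl.
have XE : X \subset E by apply: subset_trans (subsetUl X Y) _; rewrite XY subsetDl.
have fE := subsetP YE _ fY.
have eY : e \notin Y by apply: contra (vsep_notinr eE s) => /(mem_sp v).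
have eX : e \notin X by apply: contra (vsep_notinl eE s) => /(mem_sp v).
have fe : f != e by apply: contraNneq eY => <-.
have [A [B [sAB eA]]] : exists A B, vsep f A B /\ e \in A.
  have [A [B sAB]] := E_sep fE; have /vsepP[AB _ _ _ _] := sAB.
  have : e \in A :|: B by rewrite AB !inE eq_sym fe.
  by rewrite inE => /orP[eA|eB]; [exists A, B | exists B, A; rewrite vsep_sym].
have /vsepP[AB dAB rA rB rAB] := sAB.
have fB : f \notin B by apply: contra (vsep_notinr fE sAB) => /(mem_sp v).
have fA : f \notin A by apply: contra (vsep_notinl fE sAB) => /(mem_sp v).
have XYx x : (x \in X) || (x \in Y) = (x != e) && (x \in E).
  by move/setP/(_ x): XY; rewrite !inE.
have ABx x : (x \in A) || (x \in B) = (x != f) && (x \in E).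
  by move/setP/(_ x): AB; rewrite !inE.
have dXYx x : (x \in X) && (x \in Y) = false by move/pred0P/(_ x): dXY.
have dABx x : (x \in A) && (x \in B) = false by move/pred0P/(_ x): dAB.
(* Reduces a set identity to a tautology in the membership bits of one point, which [bool_cases]
   then exhausts. *)
have ptw (Z1 Z2 : {set T}) :
  (forall x, (x \in X) || (x \in Y) = (x != e) && (x \in E) ->
     (x \in A) || (x \in B) = (x != f) && (x \in E) ->
     (x \in X) && (x \in Y) = false -> (x \in A) && (x \in B) = false ->
     (x == e) ==> (x \in A) && (x != f) && (x \in E) ->
     (x == f) ==> (x \in Y) && (x != e) && (x \in E) ->
     (x \in Z1) = (x \in Z2)) -> Z1 = Z2.
  move=> H; apply/setP => x; apply: H => //.
    by apply/implyP => /eqP->; rewrite eA eq_sym fe eE.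
  by apply/implyP => /eqP->; rewrite fY fe fE.
have m1 := rk_submod v Y A; have m2 := rk_submod v X B.
have m3 := rk_submod v Y B; have m4 := rk_submod v X A.
have lYA : #|Y :&: A| < #|Y|.
  apply/proper_card/properP; split; first exact: subsetIl.
  by exists f; rewrite // inE (negPf fA) andbF.
have lYB : #|Y :&: B| < #|Y|.
  apply/proper_card/properP; split; first exact: subsetIl.
  by exists f; rewrite // inE (negPf fB) andbF.
(* If the pair (X :&: B, Y :|: A) exceeds rk E + 2, submodularity bounds the pair (Y :&: A, X :|: B)
   by rk E + 1. Then [X :|: B] spans and f + (Y :&: A) has rank at most 2, or f + (Y :&: A) is a
   side of an [e]-separation and minimality of [Y] applies. *)
have c1 : [\/ #|X :&: B| <= 3, #|Y :&: A| <= 2 | #|Y| <= 4].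
  case: (leqP (rk (X :&: B) + rk (Y :|: A)) (rk E + 2)) => le.
    constructor 1.
    have XBE : X :&: B \subset E := subset_trans (subsetIl _ _) XE.
    apply: card_rk2 => //.
    have e1 : E :\: (X :&: B) = Y :|: A.
      by apply: ptw => x; bool_cases x X Y A B E e f.
    have [|//] := small_rk XBE (leq_ltn_trans (rkS v (subsetIl X B)) rX).
    by rewrite e1.
  have le1 : rk (Y :&: A) + rk (X :|: B) <= rk E + 1.
    by clear -le m1 m2 rXY rAB; lia.
  have ZE : f |: (Y :&: A) \subset E.
    by rewrite subUset sub1set fE (subset_trans (subsetIl _ _) YE).
  have rZ := rkU1_leq v f (Y :&: A).
  have cZ : #|f |: (Y :&: A)| = #|Y :&: A|.+1 by rewrite cardsU1 inE (negPf fA) andbF.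
  case: (ltnP (rk (X :|: B)) (rk E)) => rXB; last first.
    constructor 2; have := card_rk2 ZE; rewrite cZ ltnS; apply.
    by clear -le1 rZ rXB; lia.
  constructor 3.
  have sZ : vsep e (X :|: B) (f |: (Y :&: A)).
    apply/vsepP; split=> //; last by clear -le1 rZ; lia.
    - by apply: ptw => x; bool_cases x X Y A B E e f.
    - rewrite -setI_eq0; apply/eqP.
      by apply: ptw => x; bool_cases x X Y A B E e f.
    - apply: leq_ltn_trans (rkS v _) rY.
      by rewrite subUset sub1set fY subsetIl.
  have := min _ _ _ eE sZ; rewrite cZ => /leq_trans-> //; rewrite ltnS.
  apply: card_rk2; first exact: subset_trans (subsetIl _ _) YE.
  rewrite leqNgt; apply/negP => r3.
  have rfXB := rkU1_leq v f (X :|: B).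
  have : vsep e (f |: (X :|: B)) (Y :&: A).
    apply/vsepP; split=> //; try by clear -le1 r3 rfXB; lia.
    - by apply: ptw => x; bool_cases x X Y A B E e f.
    - rewrite -setI_eq0; apply/eqP.
      by apply: ptw => x; bool_cases x X Y A B E e f.
    - exact: leq_ltn_trans (rkS v (subsetIl Y A)) rY.
  by move/(min _ _ _ eE); rewrite leqNgt lYA.
(* For the other two quadrants: a [Y :&: B] of rank at least 3 would be a side of an [f]-separation
   smaller than [Y]. *)
have c2 : #|Y :&: B| <= 3 \/ #|X :&: A| <= 3.
  case: (leqP (rk (Y :&: B) + rk (X :|: A)) (rk E + 2)) => le.
    left; apply: card_rk2; first exact: subset_trans (subsetIl _ _) YE.
    rewrite leqNgt; apply/negP => r3.
    have : vsep f (X :|: A) (Y :&: B).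
      apply/vsepP; split=> //; try by clear -le r3; lia.
      - by apply: ptw => x; bool_cases x X Y A B E e f.
      - rewrite -setI_eq0; apply/eqP.
        by apply: ptw => x; bool_cases x X Y A B E e f.
      - exact: leq_ltn_trans (rkS v (subsetIl Y B)) rY.
    by move/(min _ _ _ fE); rewrite leqNgt lYB.
  right; have XAE : X :&: A \subset E := subset_trans (subsetIl _ _) XE.
  apply: card_rk2 => //.
  have e1 : E :\: (X :&: A) = e |: (Y :|: B).
    by apply: ptw => x; bool_cases x X Y A B E e f.
  have reYB := rkU1_leq v e (Y :|: B).
  have [|//] := small_rk XAE (leq_ltn_trans (rkS v (subsetIl X A)) rX).
  by rewrite e1; clear -le reYB m1 m2 m3 m4 rXY rAB; lia.
have cX : #|X| <= #|X :&: A| + #|X :&: B|.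
  rewrite -cardsUI; apply: leq_trans (leq_addr _ _); apply/subset_leq_card.
  suff <- : X = X :&: A :|: X :&: B by [].
  by apply: ptw => x; bool_cases x X Y A B E e f.
have cB : #|B| <= #|X :&: B| + #|Y :&: B|.
  rewrite -cardsUI; apply: leq_trans (leq_addr _ _); apply/subset_leq_card.
  suff <- : B = X :&: B :|: Y :&: B by [].
  by apply: ptw => x; bool_cases x X Y A B E e f.
have cY : #|Y| <= (#|Y :&: A| + #|Y :&: B|).+1.
  rewrite (cardsD1 f) fY ltnS -cardsUI; apply: leq_trans (leq_addr _ _).
  apply/subset_leq_card; suff <- : Y :\ f = Y :&: A :|: Y :&: B by [].
  by apply: ptw => x; bool_cases x X Y A B E e f.
have cA : #|A| <= (#|X :&: A| + #|Y :&: A|).+1.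
  rewrite (cardsD1 e) eA ltnS -cardsUI; apply: leq_trans (leq_addr _ _).
  apply/subset_leq_card; suff <- : A :\ e = X :&: A :|: Y :&: A by [].
  by apply: ptw => x; bool_cases x X Y A B E e f.
case: (leqP #|Y| 6) => [Y6|Y7]; first by exists e, X, Y.
case: (leqP #|X| 6) => [X6|X7]; first by exists e, Y, X; rewrite vsep_sym.
case: (leqP #|B| 6) => [B6|B7]; first by exists f, A, B.
case: (leqP #|A| 6) => [A6|A7]; first by exists f, B, A; rewrite vsep_sym.
by exfalso; clear -c1 c2 cX cY cA cB X7 Y7 A7 B7; case: c1; case: c2; lia.
Qed.

Lemma mem_zero_sum (Z : {set T}) W y : (\sum_(z in Z) v z = 0)%R -> y \in Z ->
  (forall z, z \in Z -> z != y -> v z \in W) -> v y \in W.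
Proof.
move=> Z0 yZ ZW; move: Z0; rewrite (big_setD1 y) //= => /eqP.
rewrite addx_eq0 => /eqP->.
by apply: rpred_sum => z /setD1P[zy zZ]; apply: ZW.
Qed.

(** * The configuration of a 4-circuit Q and a cocycle Q + e *)

Section Quad.
Variables (e : T) (Q : {set T}).
Let C := e |: Q.
Let X := E :\: C.
Hypothesis CE : C \subset E.
Hypothesis eQ : e \notin Q.
Hypothesis Q4 : #|Q| = 4.
Hypothesis Q0 : (\sum_(x in Q) v x = 0)%R.
Hypothesis rX : rk E = (rk X).+1.
Hypothesis CX : forall c, c \in C -> v c \notin sp X.

Lemma XsubE : X \subset E. Proof. exact: subsetDl. Qed.

Lemma XrkE : rk X < rk E. Proof. by rewrite rX. Qed.

Lemma cardC : #|C| = 5. Proof. by rewrite /C cardsU1 eQ Q4. Qed.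

Lemma QC x : x \in Q -> x \in C. Proof. by move=> xQ; rewrite inE xQ orbT. Qed.

Lemma eC : e \in C. Proof. exact: setU11. Qed.

Lemma inX x : (x \in X) = (x \in E) && (x \notin C).
Proof. by rewrite inE andbC. Qed.

Lemma C_add c d : c \in C -> d \in C -> (v c + v d)%R \in sp X.
Proof.
move=> cC dC; apply: (memv_add_codim1 (U := sp E)); rewrite ?CX ?spS ?XsubE ?mem_sp ?(subsetP CE) //.
by rewrite -/(rk E) -/(rk X) rX.
Qed.

Lemma quad_other (x1 x2 x3 c z : T) : uniq [:: x1; x2; x3] ->
  x1 \in Q -> x2 \in Q -> x3 \in Q -> c \in Q -> z \in Q ->
  c \notin [:: x1; x2; x3] -> z != c -> z \in [:: x1; x2; x3].
Proof.
move=> u i1 i2 i3 ic iz nc zc; apply/negPn/negP => nz.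
have : size [:: z, c & [:: x1; x2; x3]] <= size (enum Q).
  apply: uniq_leq_size; first by rewrite cons_uniq inE negb_or zc nz cons_uniq nc.
  by move=> x; rewrite mem_enum !inE => /or4P[||/eqP->//|/orP[]] => [/eqP->|/eqP->|/eqP->|/eqP->].
by rewrite -cardE Q4.
Qed.

Lemma C_sub U (x1 x2 x3 : T) : uniq [:: x1; x2; x3] ->
  x1 \in Q -> x2 \in Q -> x3 \in Q ->
  v e \in U -> v x1 \in U -> v x2 \in U -> v x3 \in U ->
  forall c, c \in C -> v c \in U.
Proof.
move=> u i1 i2 i3 eU U1 U2 U3 c; rewrite !inE => /orP[/eqP->//|cQ].
have inU z : z \in [:: x1; x2; x3] -> v z \in U.
  by rewrite !inE => /or3P[]/eqP->.
case: (boolP (c \in [:: x1; x2; x3])) => [/inU//|nc].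
apply: (mem_zero_sum Q0 cQ) => z zQ zc; apply: inU.
exact: (quad_other u i1 i2 i3 cQ zQ nc zc).
Qed.

(* A small side would give a second 5-element cocycle through y; by parity it
   shares at least three elements with Q + e, and their union has at most seven. *)
Lemma vsep_quad_large y A B : y \in Q -> vsep y A B -> 7 <= #|B|.
Proof.
move=> yQ s; rewrite leqNgt ltnS; apply/negP => B6.
have yC := QC yQ; have yE := subsetP CE _ yC.
have [rA Q'B Q'4 Q'0] := small_vsep yE s B6.
set Q' := _ :\ y in Q'B Q'4 Q'0.
have notQ' z : z \in E -> z != y -> z \notin Q' -> v z \in sp A.
  by move=> zE zy; rewrite !inE zy zE /= negbK.
have Q'E z : z \in Q' -> z \in E by rewrite !inE => /and3P[].
(* Parity: if [Q'] missed [Q], all of Q - y would lie in [sp A], and so would [v y]. Likewise [Q']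
   cannot meet [C] in [h] alone, since [h] is off [sp X]. *)
have [h hQ' hQ] : exists2 h, h \in Q' & h \in Q.
  case: (exists2_or_none (fun h => h \in Q') (fun h => h \in Q)) => //= none; exfalso.
  case/negP: (vsep_notinl yE s); apply: (mem_zero_sum Q0 yQ) => z zQ zy.
  apply: notQ' => //; first exact: subsetP CE _ (QC zQ).
  by apply: contraL zQ; apply: none.
have [h2 /andP[h2Q' h2h] h2C] : exists2 h2, (h2 \in Q') && (h2 != h) & h2 \in C.
  case: (exists2_or_none (fun h2 => (h2 \in Q') && (h2 != h)) (fun h2 => h2 \in C)) => //= none; exfalso.
  case/negP: (CX (QC hQ)); apply: (mem_zero_sum Q'0 hQ') => z zQ' zh.
  by apply: mem_sp; rewrite inX Q'E // none // zQ'.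
have yQ' : y \notin Q' by rewrite !inE eqxx.
have hy : h != y by apply: contraNneq yQ' => <-.
have h2y : h2 != y by apply: contraNneq yQ' => <-.
have c3 : 3 <= #|(y |: Q') :&: C|.
  have : h2 |: [set y; h] \subset (y |: Q') :&: C.
    by rewrite !subUset !sub1set !in_setI h2C yC QC // !in_setU1 eqxx hQ' h2Q' !orbT.
  move/subset_leq_card; apply: leq_trans.
  by rewrite cardsU1 !inE negb_or h2y h2h cards2 eq_sym hy.
have cD : #|(y |: Q') :|: C| <= 7.
  by have := cardsUI (y |: Q') C; rewrite cardsU1 yQ' Q'4 cardC; move: c3; clear; lia.
(* The complement of the union has corank at most 1 and its span lies in both [sp X] and [sp A], so
   these hyperplanes coincide. Then Q - y lies in [Q'], hence in [B], and [v y] falls in [sp B]. *)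
have rD := codim1 cD.
have DX : E :\: ((y |: Q') :|: C) \subset X.
  by apply/subsetP => x; rewrite inX !in_setD in_setU negb_or => /andP[/andP[_ ->] ->].
have spX : (sp X <= sp A)%VS.
  rewrite -(sp_eq (v := v) DX); last by move: rD; rewrite rX.
  apply: sp_sub => x; rewrite in_setD !in_setU !in_set1 !negb_or -andbA => /and3P[/andP[xy xQ'] _ xE].
  exact: notQ'.
have XA : sp X = sp A by apply/eqP; rewrite eqEdim spX -/(rk A) -/(rk X); move: rX rA; clear; lia.
case/negP: (vsep_notinr yE s); apply: (mem_zero_sum Q0 yQ) => z zQ zy.
apply/mem_sp/(subsetP Q'B); rewrite !inE zy (subsetP CE _ (QC zQ)) /= -XA.
exact: CX (QC zQ).
Qed.

(** [Z] and [O] are opposite sides. Since [c] is off [sp X], the trace loses rank. A loss of two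
    would let [small_rk] bound the trace by rank 2, as its complement has rank at most rk O + 2; but
    it has at least five elements. *)
Lemma side_trace Z O c a b : Z \subset E -> 7 <= #|Z| -> rk Z < rk E ->
  rk Z + rk O <= rk E + 2 -> c \in Z -> c \in C -> #|Z :\: X| <= 2 ->
  (forall x, x \in E -> x \notin Z :&: X -> v x \in (sp O + <[v a]> + <[v b]>)%VS) ->
  [/\ sp (Z :&: X) = (sp Z :&: sp X)%VS, rk (Z :&: X) + 1 <= rk Z & 5 <= #|Z :&: X|].
Proof.
move=> ZE Z7 rZ rZO cZ cC ZX Osub.
have card5 : 5 <= #|Z :&: X|.
  by move: Z7 ZX; rewrite -(cardsID X Z); clear; lia.
have sub : (sp (Z :&: X) <= sp Z :&: sp X)%VS by rewrite subv_cap !spS ?subsetIl ?subsetIr.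
have dcap : \dim (sp Z :&: sp X) < rk Z.
  rewrite ltn_neqAle dimvS ?capvSl // andbT; apply: contra (CX cC) => /eqP d.
  have /eqP cap : (sp Z :&: sp X)%VS == sp Z by rewrite eqEdim capvSl -/(rk Z) -d /=.
  by have := mem_sp v cZ; rewrite -cap memv_cap => /andP[].
have big : rk Z <= (rk (Z :&: X)).+1.
  rewrite leqNgt; apply/negP => lt.
  have ZXE : Z :&: X \subset E := subset_trans (subsetIl _ _) ZE.
  have rco : rk (E :\: (Z :&: X)) <= rk O + 2.
    apply: (@leq_trans (\dim (sp O + <[v a]> + <[v b]>))).
      by apply/dimvS/sp_sub => x /setDP[xE xZX]; apply: Osub.
    rewrite !dim_add_line -/(rk O); clear.
    by case: (_ \in _); case: (_ \in _) => /=; lia.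
  have [||r2 _] := small_rk ZXE.
  - exact: leq_ltn_trans (rkS v (subsetIl _ _)) rZ.
  - by move: lt rco rZO; clear; lia.
  by have := card_rk2 ZXE r2; move: card5; clear; lia.
split=> //; last by rewrite addn1; apply: leq_ltn_trans (dimvS sub) dcap.
apply/eqP; rewrite eqEdim sub -/(rk _) /=.
by rewrite -ltnS; apply: leq_trans dcap big.
Qed.

(** Traces on [X] of the sides of a separation for [y], with [p] the element of [Q] on the side of
    [e]. Each side loses one rank, so the bound rk E + 2 becomes rk E = rk X + 1, a 2-separation.
    The sum of [y] and [p] is that of the two elements of [Q] in [B]. *)
Lemma quad_cross y : y \in Q -> exists p A B,
  [/\ p \in Q, p != y, A :|: B = X & [disjoint A & B]] /\
  [/\ rk A + rk B <= rk E, (v e + v p)%R \in sp A, (v y + v p)%R \in sp B,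
      5 <= #|A| & 5 <= #|B|].
Proof.
move=> yQ; have yC := QC yQ; have yE := subsetP CE _ yC.
have eE := subsetP CE _ eC.
have ey : e != y by apply: contraNneq eQ => ->.
have [A [B [s eA]]] : exists A B, vsep y A B /\ e \in A.
  have [A [B s]] := E_sep yE; have /vsepP[AB _ _ _ _] := s.
  have : e \in A :|: B by rewrite AB !inE ey.
  by rewrite inE => /orP[eA|eB]; [exists A, B | exists B, A; rewrite vsep_sym].
have B7 := vsep_quad_large yQ s.
have A7 : 7 <= #|A| by apply: (@vsep_quad_large y B A yQ); rewrite vsep_sym.
have yA := vsep_notinl yE s; have yB := vsep_notinr yE s.
have /vsepP[AB dAB rA rB rAB] := s.
have ABx x : (x \in A) || (x \in B) = (x != y) && (x \in E).
  by move/setP/(_ x): AB; rewrite !inE.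
have dABx x : (x \in A) && (x \in B) = false by move/pred0P/(_ x): dAB.
have AE : A \subset E by apply: subset_trans (subsetUl A B) _; rewrite AB subsetDl.
have BE : B \subset E by apply: subset_trans (subsetUr A B) _; rewrite AB subsetDl.
have Qside z : z \in Q -> z != y -> (z \in A) || (z \in B).
  by move=> zQ zy; rewrite ABx zy (subsetP CE) ?QC.
have [p pQ pA] : exists2 p, p \in Q & p \in A.
  case: (exists2_or_none (fun p => p \in Q) (fun p => p \in A)) => //= none; exfalso.
  case/negP: yB; apply: (mem_zero_sum Q0 yQ) => z zQ zy.
  by apply: mem_sp; have := Qside z zQ zy; rewrite (negPf (none z zQ)).
have [h hQ hB] : exists2 h, h \in Q & h \in B.
  case: (exists2_or_none (fun h => h \in Q) (fun h => h \in B)) => //= none; exfalso.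
  case/negP: yA; apply: (mem_zero_sum Q0 yQ) => z zQ zy.
  by apply: mem_sp; have := Qside z zQ zy; rewrite (negPf (none z zQ)) orbF.
have py : p != y by move: (ABx p); rewrite pA => /esym/andP[].
have hy : h != y by move: (ABx h); rewrite hB orbT => /esym/andP[].
have hA : h \notin A by move: (dABx h); rewrite hB andbT => ->.
have ph : p != h by apply: contraNneq hA => <-.
have BX : B :\: X \subset Q.
  apply/subsetP => x /setDP[xB]; rewrite inX (subsetP BE _ xB) /= negbK !inE.
  by case/orP=> [/eqP xe|//]; move: (dABx e); rewrite eA -xe xB.
(* If [h] were the only element of [Q] in [B], then [A] and [y] would span the complement of
   [B :&: X]; [small_rk] would leave at most four elements in [B]. *)
have [h' h'Q /andP[h'B h'h]] : exists2 h', h' \in Q & (h' \in B) && (h' != h).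
  case: (exists2_or_none (fun h' => h' \in Q) (fun h' => (h' \in B) && (h' != h))) => //= none; exfalso.
  have only z : z \in Q -> z \in B -> z = h.
    by move=> zQ zB; have := none z zQ; rewrite zB /= negbK => /eqP.
  have BXE : B :&: X \subset E := subset_trans (subsetIl _ _) BE.
  have r1 : rk (B :&: X) < rk B.
    apply: (rk_lt (subsetIl _ _) hB); apply: contra (CX (QC hQ)).
    exact: subvP (spS _ (subsetIr _ _)) _.
  have r2 : rk (E :\: (B :&: X)) <= (rk A).+1.
    apply: (@leq_trans (\dim (sp A + <[v y]>))); last first.
      by rewrite dim_add_line -/(rk A); clear; case: (_ \in _); rewrite ?addn0 ?addn1.
    have inW z : z \in Q -> z != h -> v z \in (sp A + <[v y]>)%VS.
      move=> zQ zh; case: (z =P y) => [->|/eqP zy].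
        exact: subvP (addvSr _ _) _ (memv_line _).
      apply: subvP (addvSl _ _) _ (mem_sp v _).
      by have /orP[//|/(only z zQ) zh'] := Qside z zQ zy; rewrite zh' eqxx in zh.
    apply/dimvS/sp_sub => x /setDP[xE xBX].
    case: (x =P y) => [->|/eqP xy]; first exact: subvP (addvSr _ _) _ (memv_line _).
    have := ABx x; rewrite xy xE => /orP[xA|xB].
      exact: subvP (addvSl _ _) _ (mem_sp v xA).
    have xQ : x \in Q by apply: (subsetP BX); rewrite inE xB andbT; move: xBX; rewrite inE xB.
    by rewrite (only x xQ xB); apply: (mem_zero_sum Q0 hQ).
  have [||r3 _] := small_rk BXE.
  - exact: leq_ltn_trans (rkS v (subsetIl _ _)) rB.
  - by move: r1 r2 rAB; clear; lia.
  have := card_rk2 BXE r3.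
  have : #|B :\: X| <= 1.
    rewrite -(cards1 h); apply/subset_leq_card/subsetP => x xBX.
    rewrite inE; apply/eqP/only; first exact: subsetP BX _ xBX.
    by case/setDP: xBX.
  by move: B7; rewrite -(cardsID X B); clear; lia.
have h'y : h' != y by move: (ABx h'); rewrite h'B orbT => /esym/andP[].
have h'A : h' \notin A by move: (dABx h'); rewrite h'B andbT => ->.
have ph' : p != h' by apply: contraNneq h'A => <-.
have Qcase z : z \in Q -> z \in [:: y; p; h; h'].
  move=> zQ; rewrite in_cons; case: (eqVneq z y) => //= zy.
  apply: (@quad_other p h h' y z) => //=; rewrite !inE ?negb_or ?ph ?ph' ?(eq_sym h) ?h'h //.
  by rewrite ![y == _]eq_sym py hy h'y.
have pBy : v p \in (sp B + <[v y]>)%VS.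
  apply: (mem_zero_sum Q0 pQ) => z /Qcase; rewrite !inE => /or4P[]/eqP-> //; rewrite ?eqxx // => _.
  - exact: subvP (addvSr _ _) _ (memv_line _).
  - exact: subvP (addvSl _ _) _ (mem_sp v hB).
  - exact: subvP (addvSl _ _) _ (mem_sp v h'B).
have pB : v p \notin sp B.
  apply: contra yB => pB; apply: (mem_zero_sum Q0 yQ) => z /Qcase.
  by rewrite !inE => /or4P[]/eqP->; rewrite ?eqxx // => _; apply: mem_sp.
have ypB : (v y + v p)%R \in sp B.
  by move: pBy; rewrite memv_add_line (negPf pB) addrC.
have trace x : x \in E -> x != y -> (x \in A) || (x \in B) by move=> xE xy; rewrite ABx xy.
have AX : A :\: X \subset [set e; p].
  apply/subsetP => x /setDP[xA]; rewrite inX (subsetP AE _ xA) /= negbK !inE.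
  case/orP=> [->//|/Qcase]; rewrite !inE => /or4P[]/eqP xz; move: xA; rewrite xz ?eqxx ?orbT //.
  - by move: (ABx y); rewrite eqxx => /norP[/negPf->].
  - by rewrite (negPf hA).
  - by rewrite (negPf h'A).
have ep : e != p by apply: contraNneq eQ => ->.
have BX2 : B :\: X \subset [set h; h'].
  apply/subsetP => x xBX; have /setDP[xB _] := xBX.
  have := Qcase x (subsetP BX _ xBX); rewrite !inE => /or4P[]/eqP xz; rewrite xz ?eqxx ?orbT //.
  - by move: (ABx y); rewrite -xz xB orbT eqxx.
  - by move: (dABx p); rewrite pA -xz xB.
(* Besides [B], only [y], [e] and [p] lie outside the trace, and [p] is already in the span of [B]
   and [y]. *)
have [||spA rA' cA] := @side_trace A B e y e AE A7 rA rAB eA eC.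
- by apply: leq_trans (subset_leq_card AX) _; rewrite cards2; case: (_ != _).
- move=> x xE xAX.
  have lift u : u \in (sp B + <[v y]>)%VS -> u \in (sp B + <[v y]> + <[v e]>)%VS.
    exact: subvP (addvSl _ _) u.
  case: (x =P y) => [->|/eqP xy].
    by apply/lift/(subvP (addvSr _ _))/memv_line.
  have /orP[xA|xB] := trace x xE xy; last first.
    by apply/lift/(subvP (addvSl _ _))/mem_sp.
  have : x \in A :\: X by rewrite inE xA andbT; move: xAX; rewrite inE xA.
  move/(subsetP AX); rewrite !inE => /orP[]/eqP->; last exact: lift.
  exact: subvP (addvSr _ _) _ (memv_line _).
have rBA : rk B + rk A <= rk E + 2 by rewrite addnC.
(* Here [y] and [h] suffice, since the zero sum of [Q] recovers [h']. *)
have [||spB rB' cB] := @side_trace B A h y h BE B7 rB rBA hB (QC hQ).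
- by apply: leq_trans (subset_leq_card BX2) _; rewrite cards2; case: (_ != _).
- have inW z : z \in Q -> z != h' -> v z \in (sp A + <[v y]> + <[v h]>)%VS.
    move/Qcase; rewrite !inE => /or4P[]/eqP-> //; rewrite ?eqxx // => _.
    + by apply/(subvP (addvSl _ _))/(subvP (addvSr _ _))/memv_line.
    + by apply/(subvP (addvSl _ _))/(subvP (addvSl _ _))/mem_sp.
    + by apply/(subvP (addvSr _ _))/memv_line.
  move=> x xE xBX; case: (x =P y) => [->|/eqP xy].
    by apply: inW; rewrite // eq_sym.
  have /orP[xA|xB] := trace x xE xy.
    by apply/(subvP (addvSl _ _))/(subvP (addvSl _ _))/mem_sp.
  have : x \in B :\: X by rewrite inE xB andbT; move: xBX; rewrite inE xB.
  move/(subsetP BX2); rewrite !inE => /orP[]/eqP->; first by apply: inW; rewrite // eq_sym.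
  exact: (mem_zero_sum Q0 h'Q).
exists p, (A :&: X), (B :&: X); split; split=> //.
- apply/setP => x; rewrite -setIUl AB in_setI in_setD1 inX.
  by case: (x =P y) => [->|_] /=; rewrite ?yC ?andbF // andbA andbb.
- by apply: disjointWl (subsetIl _ _) (disjointWr (subsetIl _ _) dAB).
- by move: rA' rB' rAB; clear; lia.
- rewrite spA memv_cap; apply/andP; split; first by rewrite rpredD // mem_sp.
  exact: C_add eC (QC pQ).
- by rewrite spB memv_cap ypB; apply: C_add yC (QC pQ).
Qed.

Lemma rk_pair x y : x \in E -> y \in E -> x != y -> rk [set x; y] = 2.
Proof.
move=> xE yE xy; rewrite rkU1 sp1 -[[set y]]setU0 rkU1 sp0 memv0 v_neq0 //.
rewrite /rk sp0 dimv0 -[<[v y]>%VS]add0v memv_add_line memv0 (negPf (v_neq0 xE)) /=.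
rewrite memv0 addx_eq0; case: eqP => // /(v_inj xE yE) e1.
by rewrite e1 eqxx in xy.
Qed.

(** [Z] has at most three elements. If all three are needed to lower the rank, each lies off a
    hyperplane of [sp X]; but the third is the sum of the other two and so lies on it. Otherwise at
    most two suffice, and with [C] they form a set of at most seven elements violating [codim1]. *)
Lemma no_line_cut Z : Z \subset X -> rk Z <= 2 -> rk X <= rk (X :\: Z).
Proof.
move=> ZX r2; rewrite leqNgt; apply/negP => lt.
have ZE : Z \subset E := subset_trans ZX XsubE.
have [Z' [Z'X Z'2 lt']] : exists Z', [/\ Z' \subset X, #|Z'| <= 2 & rk (X :\: Z') < rk X].
  have := card_rk2 ZE r2; rewrite leq_eqVlt => /orP[/eqP c3|c2]; last by exists Z.
  case: (exists2_or_none (fun z => z \in Z) (fun z => rk (z |: (X :\: Z)) < rk X)).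
    move=> [z zZ rz]; exists (Z :\ z); split.
    - exact: subset_trans (subsetDl _ _) ZX.
    - by move: c3; rewrite (cardsD1 z) zZ add1n => -[->].
    - suff <- : z |: (X :\: Z) = X :\: (Z :\ z) by [].
      rewrite setDDr setUC; congr setU; apply/esym/setIidPr.
      by rewrite sub1set (subsetP ZX).
  move=> big; exfalso.
  have zW z : z \in Z -> v z \notin sp (X :\: Z) /\ rk X <= (rk (X :\: Z)).+1.
    move=> /big; rewrite -leqNgt rkU1 => le.
    case: (boolP (v z \in _)) le => /= _; last by rewrite addn1.
    by rewrite addn0 leqNgt lt.
  have /card_gt2P[a [b [c [[aZ bZ cZ] [ab bc ca]]]]] : 2 < #|Z| by rewrite c3.
  have neq x y : x \in Z -> y \in Z -> x != y -> v x != v y.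
    move=> xZ yZ; apply: contra => /eqP xy; apply/eqP.
    by apply: v_inj => //; apply: (subsetP ZE).
  have nz x : x \in Z -> v x != 0%R by move=> xZ; apply/v_neq0/(subsetP ZE).
  have := mem_dim2 r2 (mem_sp v aZ) (mem_sp v bZ) (nz a aZ) (nz b bZ) (neq _ _ aZ bZ ab) (mem_sp v cZ).
  rewrite (negPf (nz c cZ)) (negPf (neq _ _ cZ aZ ca)) eq_sym (negPf (neq _ _ bZ cZ bc)) /= => /eqP cab.
  have [aW dW] := zW a aZ; have [bW _] := zW b bZ; have [cW _] := zW c cZ.
  case/negP: cW; rewrite cab; apply: (memv_add_codim1 (U := sp X)) => //; first exact/spS/subsetDl.
    by apply/mem_sp/(subsetP ZX).
  by apply/mem_sp/(subsetP ZX).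
have c7 : #|C :|: Z'| <= 7.
  by have := cardsUI C Z'; rewrite cardC; move: Z'2; clear; lia.
have := codim1 c7.
have -> : E :\: (C :|: Z') = X :\: Z' by rewrite /X -setDDl.
by rewrite rX ltnS leqNgt lt'.
Qed.

(** [W] bounds the rank of E - Z, so [small_rk] gives rank at most 2. [no_line_cut] together with rk
    E = rk X + 1 lowers this to 1, and distinct elements are not parallel. *)
Lemma small_trace Z W n : Z \subset X -> (forall c, c \in C -> v c \in W) ->
  (sp (X :\: Z) <= W)%VS -> \dim W <= rk (X :\: Z) + n ->
  rk Z + rk (X :\: Z) + n <= rk E + 2 -> rk Z + rk (X :\: Z) <= rk E -> #|Z| <= 1.
Proof.
move=> ZX CW XW dW rZ rZ'.
have ZE : Z \subset E := subset_trans ZX XsubE.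
have le : rk (E :\: Z) <= \dim W.
  apply/dimvS/sp_sub => x /setDP[xE xZ]; case: (boolP (x \in C)) => [/CW//|xC].
  by apply: subvP XW _ (mem_sp v _); rewrite in_setD inX xZ xE.
have [||r2 _] := small_rk ZE.
- exact: leq_ltn_trans (rkS v ZX) XrkE.
- by move: le dW rZ; clear; lia.
have r1 : rk Z <= 1.
  by have := no_line_cut ZX r2; move: rZ'; rewrite rX; clear; lia.
rewrite leqNgt; apply/negP => /card_gt1P[a [b [aZ bZ ab]]].
have /(rkS v) : [set a; b] \subset Z by rewrite subUset !sub1set aZ.
by rewrite rk_pair ?(subsetP ZE) // leqNgt ltnS r1.
Qed.

Lemma small_trace2 Z (a b : T) x1 x2 x3 (W := (sp (X :\: Z) + <[v a]> + <[v b]>)%VS) :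
  Z \subset X -> rk Z + rk (X :\: Z) <= rk E ->
  uniq [:: x1; x2; x3] -> x1 \in Q -> x2 \in Q -> x3 \in Q ->
  v e \in W -> v x1 \in W -> v x2 \in W -> v x3 \in W -> #|Z| <= 1.
Proof.
move=> ZX rZ u i1 i2 i3 eW w1 w2 w3.
apply: (@small_trace Z W 2) => //; last by rewrite leq_add2r.
- exact: C_sub u i1 i2 i3 eW w1 w2 w3.
- by apply: subv_trans (addvSl _ _) (addvSl _ _).
- by rewrite /W !dim_add_line -/(rk _); clear; case: (_ \in _); case: (_ \in _) => /=; lia.
Qed.

(* With k the partner of g, the case k = f is special: there B1 and B2 only share
   the relation f + g, so B1 :|: B2 absorbs Q + e up to rank 3 rather than 2. *)
Lemma no_quad : False.
Proof.
have [f fQ] : exists f, f \in Q by apply/card_gt0P; rewrite Q4.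
have [g [A1 [B1 [[gQ gf AB1 dAB1] [r1 eg fg cA1 cB1]]]]] := quad_cross fQ.
have [k [A2 [B2 [[kQ kg AB2 dAB2] [r2 ek gk cA2 cB2]]]]] := quad_cross gQ.
have AB1x x : (x \in A1) || (x \in B1) = (x \in X) by rewrite -AB1 inE.
have AB2x x : (x \in A2) || (x \in B2) = (x \in X) by rewrite -AB2 inE.
have d1x x : (x \in A1) && (x \in B1) = false by move/pred0P/(_ x): dAB1.
have d2x x : (x \in A2) && (x \in B2) = false by move/pred0P/(_ x): dAB2.
have co (Z Z' : {set T}) : (forall x, (x \in A1) || (x \in B1) = (x \in X) ->
    (x \in A2) || (x \in B2) = (x \in X) ->
    (x \in A1) && (x \in B1) = false -> (x \in A2) && (x \in B2) = false ->
    (x \notin Z) && (x \in X) = (x \in Z')) -> X :\: Z = Z'.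
  by move=> H; apply/setP => x; rewrite in_setD H.
have c11 : X :\: (A1 :&: A2) = B1 :|: B2.
  by apply: co => x; rewrite in_setI in_setU; do 5!case: (_ \in _).
have c12 : X :\: (A1 :&: B2) = B1 :|: A2.
  by apply: co => x; rewrite in_setI in_setU; do 5!case: (_ \in _).
have c21 : X :\: (B1 :&: A2) = A1 :|: B2.
  by apply: co => x; rewrite in_setI in_setU; do 5!case: (_ \in _).
have c22 : X :\: (B1 :&: B2) = A1 :|: A2.
  by apply: co => x; rewrite in_setI in_setU; do 5!case: (_ \in _).
have A1X : A1 \subset X by rewrite -AB1 subsetUl.
have B1X : B1 \subset X by rewrite -AB1 subsetUr.
have A2X : A2 \subset X by rewrite -AB2 subsetUl.
have B2X : B2 \subset X by rewrite -AB2 subsetUr.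
have split1 Z : Z \subset X -> #|Z| = #|Z :&: A2| + #|Z :&: B2|.
  move=> ZX; rewrite -cardsUI -setIUr AB2 (setIidPl ZX) -setIIr.
  by move: dAB2; rewrite -setI_eq0 => /eqP->; rewrite setI0 cards0 addn0.
have split2 Z : Z \subset X -> #|Z| = #|A1 :&: Z| + #|B1 :&: Z|.
  move=> ZX; rewrite -cardsUI -setIUl AB1 (setIidPr ZX) -setIIl.
  by move: dAB1; rewrite -setI_eq0 => /eqP->; rewrite set0I cards0 addn0.
have nA1 := split1 A1 A1X; have nB1 := split1 B1 B1X.
have nA2 := split2 A2 A2X; have nB2 := split2 B2 B2X.
have m1 := rk_submod v A1 A2; have m2 := rk_submod v B1 B2.
have m3 := rk_submod v A1 B2; have m4 := rk_submod v B1 A2.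
have S11 : A1 :&: A2 \subset X := subset_trans (subsetIl _ _) A1X.
have S12 : A1 :&: B2 \subset X := subset_trans (subsetIl _ _) A1X.
have S21 : B1 :&: A2 \subset X := subset_trans (subsetIl _ _) B1X.
have S22 : B1 :&: B2 \subset X := subset_trans (subsetIl _ _) B1X.
have inl Y Z u : u \in sp Y -> u \in sp (Y :|: Z) by apply/subvP/spS/subsetUl.
have inr Y Z u : u \in sp Z -> u \in sp (Y :|: Z) by apply/subvP/spS/subsetUr.
have g1 W (a b : T) u : u \in W -> u \in (W + <[v a]> + <[v b]>)%VS.
  by move=> uW; do 2!apply: subvP (addvSl _ _) _ _.
have g2 W (a b : T) : v a \in (W + <[v a]> + <[v b]>)%VS.
  by apply/(subvP (addvSl _ _))/(subvP (addvSr _ _))/memv_line.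
have g3 W (a b : T) : v b \in (W + <[v a]> + <[v b]>)%VS.
  by apply/(subvP (addvSr _ _))/memv_line.
have step W x y : (v x + v y)%R \in W -> v x \in W -> v y \in W.
  by move=> xy xW; rewrite memv_addr in xy.
case: (eqVneq k f) => [kf|kf].
  rewrite {}kf {k kQ kg} in ek gk.
  have [h hQ hfg] : exists2 h, h \in Q & h \notin [set f; g].
    apply/subsetPn; apply: contraTN isT => /subset_leq_card.
    by rewrite Q4 cards2; case: (_ != _).
  have u : uniq [:: f; g; h].
    move: hfg; rewrite !inE negb_or => /andP[hf hg].
    by rewrite /= !inE negb_or [f == g]eq_sym gf [f == h]eq_sym hf [g == h]eq_sym hg.
  have k22 : rk (B1 :&: B2) + rk (A1 :|: A2) <= rk E -> #|B1 :&: B2| <= 1.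
    rewrite -c22 => rZ; apply: (small_trace2 (a := e) (b := h) S22 rZ u) => //; rewrite c22.
      by apply: (step _ e); last exact: g2; apply/g1/inr.
    by apply: (step _ e); last exact: g2; apply/g1/inl.
  have k12 : rk (A1 :&: B2) + rk (B1 :|: A2) <= rk E -> #|A1 :&: B2| <= 1.
    rewrite -c12 => rZ; apply: (small_trace2 (a := e) (b := h) S12 rZ u) => //; rewrite c12.
      by apply: (step _ e); last exact: g2; apply/g1/inr.
    apply: (step _ f); first exact/g1/inl.
    by apply: (step _ e); last exact: g2; apply/g1/inr.
  have k21 : rk (B1 :&: A2) + rk (A1 :|: B2) <= rk E -> #|B1 :&: A2| <= 1.
    rewrite -c21 => rZ; apply: (small_trace2 (a := e) (b := h) S21 rZ u) => //; rewrite c21.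
      apply: (step _ g); first exact/g1/inr.
      by apply: (step _ e); last exact: g2; apply/g1/inl.
    by apply: (step _ e); last exact: g2; apply/g1/inl.
  (* Three extra vectors cost one in the bound. Submodularity bounds the two opposite pairs by 2 rk
     E in total, so this bound or the one in [k22] still holds. *)
  have k11 : rk (A1 :&: A2) + rk (B1 :|: B2) <= rk X -> #|A1 :&: A2| <= 1.
    rewrite -c11 => rZ.
    pose W := (sp (X :\: (A1 :&: A2)) + <[v e]> + <[v f]> + <[v h]>)%VS.
    have lift u' : u' \in (sp (X :\: (A1 :&: A2)) + <[v e]> + <[v f]>)%VS -> u' \in W.
      exact: subvP (addvSl _ _) u'.
    apply: (@small_trace _ W 3) => //; try by move: rZ; rewrite rX; clear; lia.
    - apply: (C_sub u fQ gQ hQ).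
      + exact/lift/g2.
      + exact/lift/g3.
      + by apply: (step _ f); [apply/lift/g1; rewrite c11; apply: inl | apply/lift/g3].
      + exact: subvP (addvSr _ _) _ (memv_line _).
    - by apply/subvP => u' /(g1 _ e f) /lift.
    - by rewrite /W !dim_add_line -/(rk _); clear; do 3!case: (_ \in _) => /=; lia.
  move: k11 k12 k21 k22 m1 m2 m3 m4 r1 r2 nA1 nB1 nA2 nB2 cA1 cB1 cA2 cB2 rX; clear.
  case: (leqP #|A1 :&: A2| 1); case: (leqP #|A1 :&: B2| 1) => *; lia.
have u : uniq [:: f; g; k].
  by rewrite /= !inE negb_or [f == g]eq_sym gf [f == k]eq_sym kf [g == k]eq_sym kg.
(* With [k] distinct from [f], every union of two sides contains recorded sums that recover [g] and
   [k] from [e] and [f]. *)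
have k22 : rk (B1 :&: B2) + rk (A1 :|: A2) <= rk E -> #|B1 :&: B2| <= 1.
  rewrite -c22 => rZ; apply: (small_trace2 (a := e) (b := f) S22 rZ u) => //; rewrite c22.
    by apply: (step _ e); last exact: g2; apply/g1/inl.
  by apply: (step _ e); last exact: g2; apply/g1/inr.
have k12 : rk (A1 :&: B2) + rk (B1 :|: A2) <= rk E -> #|A1 :&: B2| <= 1.
  rewrite -c12 => rZ; apply: (small_trace2 (a := e) (b := f) S12 rZ u) => //; rewrite c12.
    by apply: (step _ f); last exact: g3; apply/g1/inl.
  by apply: (step _ e); last exact: g2; apply/g1/inr.
have k21 : rk (B1 :&: A2) + rk (A1 :|: B2) <= rk E -> #|B1 :&: A2| <= 1.
  rewrite -c21 => rZ; apply: (small_trace2 (a := e) (b := f) S21 rZ u) => //; rewrite c21.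
    by apply: (step _ e); last exact: g2; apply/g1/inl.
  apply: (step _ g); first exact/g1/inr.
  by apply: (step _ e); last exact: g2; apply/g1/inl.
have k11 : rk (A1 :&: A2) + rk (B1 :|: B2) <= rk E -> #|A1 :&: A2| <= 1.
  rewrite -c11 => rZ; apply: (small_trace2 (a := e) (b := f) S11 rZ u) => //; rewrite c11.
    by apply: (step _ f); last exact: g3; apply/g1/inl.
  apply: (step _ g); first exact/g1/inr.
  by apply: (step _ f); last exact: g3; apply/g1/inl.
(* One quadrant of each opposite pair has at most one element; two such quadrants fill a side, which
   has at least five. *)
move: k11 k12 k21 k22 m1 m2 m3 m4 r1 r2 nA1 nB1 nA2 nB2 cA1 cB1 cA2 cB2; clear.
lia.
Qed.

End Quad.

Lemma large_cocycles_absurd : False.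
Proof.
have [e [X0 [Y [eE s Y6]]]] := exists_small_vsep.
have [rX QY Q4 Q0] := small_vsep eE s Y6.
have eX := vsep_notinl eE s; have /vsepP[XY _ _ _ _] := s.
have eC : e |: (cocyc (sp X0) :\ e) = cocyc (sp X0) by rewrite setD1K // inE eE eX.
have X0X : X0 \subset E :\: cocyc (sp X0).
  apply/subsetP => x xX; rewrite !inE mem_sp // andbF /=.
  by have : x \in X0 :|: Y; [rewrite inE xX | rewrite XY !inE => /andP[]].
have spX : sp (E :\: cocyc (sp X0)) = sp X0.
  by apply/eqP; rewrite eqEsubv sp_cocyc spS.
apply: (@no_quad e (cocyc (sp X0) :\ e)) => //; rewrite ?eC ?cocyc_sub ?setD11 //.
  by rewrite {2}/rk spX.
by move=> c; rewrite spX inE => /andP[].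
Qed.

End LargeCocycles.

(** The rank form of a cocircuit; see [cocircuit_min_cocycle]. *)
Definition min_cocycle C := [/\ C \subset E, rk (E :\: C) < rk E &
  forall C', C' \proper C -> rk (E :\: C') = rk E].

(** A cocycle with at most three elements has rank at most 3, and with its complement violates
    4-connectivity. So a 4-element cocycle is minimal. *)
Lemma min_cocycle4_rk_ge4 : 4 <= rk E -> exists2 C, min_cocycle C & #|C| = 4.
Proof.
move=> r4.
have ge4 (C : {set T}) : C \subset E -> rk (E :\: C) < rk E -> 4 <= #|C|.
  move=> CE rC; rewrite leqNgt ltnS; apply/negP => C3.
  have rC3 := leq_trans (rk_card v C) C3.
  have : rk E + 3 <= rk C + rk (E :\: C).
    apply: E_conn => //; last by lia.
      by rewrite setDE setUIr setUCr setIT; apply/setUidPr.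
    by rewrite -setI_eq0 setDE setICA setICr setI0.
  by lia.
case: (exists2_or_none (fun C : {set T} => (C \subset E) && (rk (E :\: C) < rk E))
    (fun C => #|C| <= 4)) => [[C /andP[CE rC] C4]|none].
  have C4' : #|C| = 4 by apply/eqP; rewrite eqn_leq C4 ge4.
  exists C => //; split=> // C' C'C; apply/eqP; rewrite eqn_leq rkS ?subsetDl //.
  rewrite leqNgt; apply/negP => /ge4; rewrite (subset_trans (proper_sub C'C)) //.
  by move/(_ isT); have := proper_card C'C; rewrite C4'; lia.
exfalso; apply: large_cocycles_absurd => // C CE rC.
by rewrite ltnNge none // CE.
Qed.

(** * Small rank *)

(** In rank 3, the three lines through a point [x] meet E - x in disjoint sets, and each misses at
    most four elements: translating by one of them puts the others in a plane. If each missed at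
    most three, E - x would have at most four elements. *)
Lemma min_cocycle4_rk_le3 : rk E <= 3 -> 6 <= #|E| -> exists2 C, min_cocycle C & #|C| = 4.
Proof.
move=> r3 E6.
have rE : rk E = 3.
  apply/eqP; rewrite eqn_leq r3 ltnNge; apply/negP => r2.
  by have := card_rk2 (subxx E) r2; lia.
have [x xE] : exists x, x \in E by apply/card_gt0P; lia.
have x0 := v_neq0 xE.
have rx : rk [set x] = 1 by rewrite /rk sp1 dim_vline x0.
have [w1 w1E w1x] : exists2 y, y \in E & v y \notin sp [set x] by apply: rk_exists; lia.
have rw1 : rk (w1 |: [set x]) = 2 by rewrite rkU1 w1x rx.
have [w2 w2E w2x] : exists2 y, y \in E & v y \notin sp (w1 |: [set x]).
  by apply: rk_exists; lia.
move: w2x; rewrite spU1 memv_add_line negb_or => /andP[w2x w12].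
pose H u := (sp [set x] + <[u]>)%VS; pose D := E :\ x; pose C u := cocyc (H u).
have xH u : v x \in H u by apply: subvP (addvSl _ _) _ _; rewrite mem_sp ?inE.
have CD u : C u \subset D.
  apply/subsetP => y; rewrite !inE => /andP[yE yH]; rewrite yE andbT.
  by apply: contra yH => /eqP->.
have DU y : y \in D -> v y \notin sp [set x].
  move=> /setD1P[yx yE]; apply: contra yx; rewrite sp1 -[<[v x]>%VS]add0v.
  by rewrite memv_add_line !memv0 addx_eq0 (negPf (v_neq0 yE)) => /eqP/v_inj->.
have HsubE u : u \in sp E -> (H u <= sp E)%VS.
  by move=> uE; rewrite subv_add spS ?sub1set //.
have dH u : u \notin sp [set x] -> \dim (H u) = 2.
  by move=> ux; rewrite dim_add_line ux -/(rk _) rx.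
have C4 u : u \in sp E -> u \notin sp [set x] -> #|C u| <= 4.
  move=> uE ux; case: (set_0Vmem (C u)) => [->|[c cC]]; first by rewrite cards0.
  rewrite (cardsD1 c) cC ltnS.
  have CE z : z \in C u -> z \in E /\ v z \notin H u by rewrite inE => /andP[].
  have [cE cH] := CE c cC.
  apply: (card_dim2 (w := fun z => (v z + v c)%R) (U := H u)); first by rewrite dH.
    by move=> y z /setD1P[_ /CE[yE _]] /setD1P[_ /CE[zE _]] /addIr; apply: v_inj.
  move=> z /setD1P[zc /CE[zE zH]]; split.
    by apply: (memv_add_codim1 (HsubE u uE)) => //; rewrite ?mem_sp // dH // -/(rk E) rE.
  by rewrite addx_eq0; apply: contra zc => /eqP/v_inj->.
pose N u := [set y in D | v y \in H u].
have CN u : #|C u| + #|N u| = #|D|.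
  have ND : D :&: N u = N u.
    by apply/setIidPr/subsetP => y; rewrite inE => /andP[].
  have DN : D :\: N u = C u.
    apply/setP => y; rewrite in_setD [y \in N u]inE [y \in C u]inE.
    case: (boolP (y \in D)) => [/setD1P[_ ->]|yD]; first by rewrite andbT.
    apply/esym; rewrite andbF; apply: contraNF yD => yC.
    by apply: (subsetP (CD u)); rewrite inE.
  by rewrite -(cardsID (N u) D) ND DN addnC.
have disj u u' : (u + u')%R \notin sp [set x] -> N u :&: N u' = set0.
  move=> uu'x; apply/setP => y; rewrite in_setI in_set0 inE [y \in N u']inE.
  apply/negP => /andP[/andP[yD h1] /andP[_ h2]].
  move: h1 h2; rewrite !memv_add_line (negPf (DU y yD)) /= => h1 h2.
  case/negP: uu'x; rewrite -[(u + u')%R]add0r -(addxx (v y)) addrACA.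
  exact: rpredD.
have [u [uE ux uC]] : exists u, [/\ u \in sp E, u \notin sp [set x] & #|C u| = 4].
  pose u1 := v w1; pose u2 := v w2; pose u3 := (u1 + u2)%R.
  have u1E : u1 \in sp E by apply: mem_sp.
  have u2E : u2 \in sp E by apply: mem_sp.
  have u3E : u3 \in sp E by apply: rpredD.
  have u3x : u3 \notin sp [set x] by rewrite /u3 addrC.
  have e12 := disj u1 u2 u3x.
  have e13 : N u1 :&: N u3 = set0 by apply: disj; rewrite addxK.
  have e23 : N u2 :&: N u3 = set0 by apply: disj; rewrite /u3 [(u1 + _)%R]addrC addxK.
  have cN : #|N u1| + #|N u2| + #|N u3| <= #|D|.
    rewrite -(cardsUI (N u1)) e12 cards0 addn0 -cardsUI setIUl e13 e23 setU0 cards0 addn0.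
    by apply: subset_leq_card; rewrite !subUset; do !(apply/andP; split);
      apply/subsetP => y; rewrite inE => /andP[].
  have cD : 5 <= #|D| by move: E6; rewrite (cardsD1 x) xE.
  have := C4 u1 u1E w1x; have := C4 u2 u2E w2x; have := C4 u3 u3E u3x.
  have := CN u1; have := CN u2; have := CN u3.
  case: (eqVneq #|C u1| 4) => [|n1]; first by exists u1.
  case: (eqVneq #|C u2| 4) => [|n2]; first by exists u2.
  case: (eqVneq #|C u3| 4) => [|n3]; first by exists u3.
  by move: n1 n2 n3 cN cD; clear; lia.
have EH := sp_cocyc (H u).
(* E - x has a fifth element, so the complement of [C u] spans the whole line [H u]. *)
have [d dN] : exists d, d \in N u.
  by apply/card_gt0P; have := CN u; move: E6; rewrite (cardsD1 x) xE -/D uC; clear; lia.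
have [dD dH'] : d \in D /\ v d \in H u by move: dN; rewrite inE => /andP[].
have dE : d \in E by case/setD1P: dD.
have xdC : d |: [set x] \subset E :\: C u.
  by rewrite subUset !sub1set !in_setD dE xE !andbT !inE xH dH' !andbF.
have r2 : 2 <= rk (E :\: C u).
  by apply: leq_trans (rkS v xdC); rewrite rkU1 DU // rx.
have spH : sp (E :\: C u) = H u by apply/eqP; rewrite eqEdim EH dH.
have r2' : rk (E :\: C u) = 2 by rewrite /rk spH dH.
exists (C u) => //; split; [exact: cocyc_sub | by rewrite r2' rE |].
move=> C' /properP[C'C [c cC cC']]; apply/eqP; rewrite eqn_leq rkS ?subsetDl //=.
have [cE cH] : c \in E /\ v c \notin H u by move: cC; rewrite inE => /andP[].
have : c |: (E :\: C u) \subset E :\: C'.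
  by rewrite subUset sub1set in_setD cC' cE setDS.
by move/(rkS v); rewrite rkU1 spH cH r2' rE.
Qed.

Lemma exists_min_cocycle4 : 6 <= #|E| -> exists2 C, min_cocycle C & #|C| = 4.
Proof.
by move=> E6; case: (leqP 4 (rk E)) => r; [apply: min_cocycle4_rk_ge4 | apply: min_cocycle4_rk_le3].
Qed.

End Separations.

(** * From matroids to configurations *)

Section Matroid.
Variables (T : finType) (M : matroid T) (V : vectType 'F_2) (v : T -> V).
Hypothesis v_indep : forall I : {set T}, I \subset ground M ->
  (I \in indep M) = free [seq v e | e in I].
Implicit Types (X Y I : {set T}).

Lemma span_image X : <<[seq v e | e in X]>>%VS = sp v X.
Proof. by rewrite span_def big_map /sp big_enum. Qed.

Lemma rk_indep I : I \in indep M -> rk v I = #|I|.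
Proof.
move=> Ii; have := Ii; rewrite v_indep ?indep_ground // => /eqP.
by rewrite span_image size_map -cardE.
Qed.

Lemma rank_rk X : X \subset ground M -> rank M X = rk v X.
Proof.
move=> XE; apply/eqP; rewrite eqn_leq; apply/andP; split.
  by apply/bigmax_leqP => I /andP[Ii IX]; rewrite -(rk_indep Ii) rkS.
pose P := [pred I : {set T} | (I \in indep M) && (I \subset X)].
have P0 : P set0 by rewrite /= indep0 sub0set.
have [I /maxsetP[/= /andP[Ii IX] Imax] _] := maxset_exists P0.
apply: (@leq_trans #|I|); last first.
  by apply: (@leq_bigmax_cond _ _ (fun J : {set T} => #|J|)); rewrite Ii IX.
rewrite -(rk_indep Ii); apply: dimvS; apply: sp_sub => x xX.
apply/negPn/negP => xI.
have xnI : x \notin I by apply: contra xI; apply: mem_sp.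
case/negP: (xnI); rewrite -(Imax (x |: I)) ?setU11 ?subsetUr //= subUset sub1set xX IX andbT.
have xIE : x |: I \subset ground M by rewrite subUset sub1set (subsetP XE) //= indep_ground.
rewrite v_indep //.
have : perm_eq (enum (x |: I)) (x :: enum I).
  apply: uniq_perm; rewrite /= ?enum_uniq ?mem_enum ?xnI //.
  by move=> y; rewrite !inE !mem_enum !inE.
move/(perm_map v)/perm_free->; rewrite /= free_cons span_image xI /=.
by rewrite andbT -(v_indep (indep_ground Ii)).
Qed.

Lemma rank_delete e X : X \subset ground M :\ e -> rank (delete M e) X = rank M X.
Proof.
move=> XE; apply: eq_bigl => I; rewrite inE -andbA.
by case: (boolP (I \subset X)) => [IX|]; rewrite ?andbF // (subset_trans IX XE).
Qed.

Lemma vconn4_vertically_connected :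
  vertically_connected M 4 -> vconn4 v (ground M).
Proof.
move=> conn X Y XY dXY rX rY; rewrite leqNgt; apply/negP => lt.
have XE : X \subset ground M by rewrite -XY subsetUl.
have YE : Y \subset ground M by rewrite -XY subsetUr.
have YX : ground M :\: X = Y.
  by rewrite -XY setDUl setDv set0U; apply/setDidPl; rewrite disjoint_sym.
have le := rkU v X Y; rewrite XY in le.
(* The least [j] exceeding the connectivity; it is at most both ranks exactly because both sides are
   nonspanning. *)
apply: (conn (rk v X + rk v Y - rk v (ground M)).+1 X Y) => //; first by lia.
split=> //; first by rewrite /connectivity YX !rank_rk.
by rewrite leq_min !rank_rk //; lia.
Qed.

Lemma vsep_delete e : e \in ground M -> ~ vertically_connected (delete M e) 4 ->
  exists X Y, vsep v (ground M) e X Y.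
Proof.
move=> eE nconn.
(* There are finitely many pairs, so existence is decidable and [nconn] can be refuted. *)
case: (boolP [exists X : {set T}, [exists Y : {set T}, vsep v (ground M) e X Y]]).
  by move=> /existsP[X /existsP[Y s]]; exists X, Y.
rewrite negb_exists => /forallP none; case: nconn => j X Y j0 j4 [/= XY dXY lt le].
have /negP[] := none X; apply/existsP; exists Y; apply/vsepP.
have XE : X \subset ground M :\ e by rewrite -XY subsetUl.
have YE : Y \subset ground M :\ e by rewrite -XY subsetUr.
have YX : (ground M :\ e) :\: X = Y.
  by rewrite -XY setDUl setDv set0U; apply/setDidPl; rewrite disjoint_sym.
move: lt le; rewrite /connectivity /= YX leq_min !rank_delete //.
rewrite !rank_rk ?subsetDl ?(subset_trans XE) ?(subset_trans YE) ?subsetDl //.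
have := rkS v (subsetDl (ground M) [set e]).
by move=> *; split=> //; lia.
Qed.

(** A set avoids some basis exactly when its complement spans, so dual circuits are the minimal sets
    with nonspanning complement. *)
Lemma cocircuit_min_cocycle C : min_cocycle v (ground M) C -> is_cocircuit M C.
Proof.
case=> CE rC Cmin.
have dual_rk (I : {set T}) : I \subset ground M ->
    (I \in dual_indep M) = (rk v (ground M) <= rk v (ground M :\: I)).
  move=> IE; rewrite inE IE /=; apply/existsP/idP => [[B /andP[Bb dIB]]|le].
    have Bi : B \in indep M by case/maxsetP: Bb.
    have BI : B \subset ground M :\: I by rewrite subsetD indep_ground // disjoint_sym.
    apply: leq_trans (rkS v BI); rewrite (rk_indep Bi) -(rank_rk (subxx (ground M))).
    by apply/bigmax_leqP => J /andP[Ji _]; apply: (card_indep_basis Bb Ji).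
  have : exists2 J, J \in indep M & (J \subset ground M :\: I) && (#|J| == rank M (ground M :\: I)).
    have [|J] := @eq_bigmax_cond _ [pred J in indep M | J \subset ground M :\: I] (fun J : {set T} => #|J|).
      by apply/card_gt0P; exists set0; rewrite !inE indep0 sub0set.
    by rewrite inE => /andP[Ji JI] eJ; exists J; rewrite // JI; apply/eqP; rewrite -eJ.
  case=> J Ji /andP[JI /eqP cJ]; exists J; apply/andP; split; last first.
    by move: JI; rewrite subsetD disjoint_sym => /andP[].
  apply/maxsetP; split=> // K Ki JK; apply/eqP; rewrite eq_sym eqEcard JK /=.
  rewrite cJ rank_rk ?subsetDl //; apply: leq_trans le.
  by rewrite -(rk_indep Ki) rkS // indep_ground.
apply/minsetP; split; first by rewrite /= CE dual_rk // -ltnNge.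
move=> D /= /andP[DE]; rewrite dual_rk // -ltnNge => rD DC.
apply/eqP; rewrite eqEproper DC; apply/negP => /Cmin rD'.
by rewrite rD' ltnn in rD.
Qed.

End Matroid.

Theorem theorem1p5 (T : finType) (M : matroid T) :
  binary M ->
  minimally_vertically_connected M 4 ->
  6 <= #|ground M| ->
  exists2 C : {set T}, is_cocircuit M C & #|C| = 4.
Proof.
move=> [m [v vE]] [conn del] E6.
have [|e eE|C Cmin C4] := @exists_min_cocycle4 _ _ v (ground M) _ _ E6.
- exact: vconn4_vertically_connected vE conn.
- exact: (vsep_delete vE eE (del e eE)).
- by exists C => //; apply: (cocircuit_min_cocycle vE Cmin).
Qed.
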